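(* Let $K_1$ and $K_2$ be centered convex bodies in $3$-dimensional Euclidean space $\mathbb{E}^3$ such that $$\lambda_2(K_1\cap u^{\perp})\le \lambda_2(K_2\cap u^{\perp})$$ for all $u$ in the unit sphere $S^2$. Then $$\lambda_3(K_1)\le \lambda_3(K_2).$$ (That is, the Busemann-Petty problem has an affirmative answer in $\mathbb{E}^3$.)
   Context: A convex body in $\mathbb{E}^n$ is a compact convex set with nonempty interior. A convex body $K$ is centered if it is centrally symmetric with center at the origin, i.e. $K=-K$. For $u\in S^{n-1}$ (the unit sphere of $\mathbb{E}^n$), $u^{\perp}$ denotes the hyperplane through the origin orthogonal to $u$. $\lambda_k$ denotes $k$-dimensional Lebesgue measure, identified with $k$-dimensional Hausdorff measure; thus in $\mathbb{E}^3$, $\lambda_2(K\cap u^\perp)$ is the area of the planar section $K\cap u^\perp$ and $\lambda_3(K)$ is the volume of $K$. The Busemann-Petty problem in $\mathbb{E}^n$ asks: if $K_1,K_2$ are centered convex bodies in $\mathbb{E}^n$ with $\lambda_{n-1}(K_1\cap u^{\perp})\le\lambda_{n-1}(K_2\cap u^{\perp})$ for all $u\in S^{n-1}$, is it true that $\lambda_n(K_1)\le\lambda_n(K_2)$? *)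

(* Defs.v *)
From HB Require Import structures.
From mathcomp Require Import all_boot all_order all_algebra.
From mathcomp Require Import all_classical all_reals all_analysis.
From mathcomp Require Import ring lra.

Set Implicit Arguments.
Unset Strict Implicit.
Unset Printing Implicit Defensive.

Import Order.TTheory GRing.Theory Num.Theory.
Import numFieldNormedType.Exports.

Local Open Scope classical_set_scope.
Local Open Scope ring_scope.

(* E^n is 'rV[R]_n with the inner product [dot]. The library's norm `|x| on
   'rV[R]_n is the sup norm: it induces the usual topology, used below for
   [compact] and [interior], but lengths must be measured with [enorm]. *)

Definition dot (R : realType) (n : nat) (x y : 'rV[R]_n) : R :=
  \sum_(i < n) x 0 i * y 0 i.

Definition enorm (R : realType) (n : nat) (x : 'rV[R]_n) : R :=
  Num.sqrt (dot x x).

Definition unit_sphere (R : realType) (n : nat) : set 'rV[R]_n :=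
  [set u | enorm u = 1].

Definition perp (R : realType) (n : nat) (u : 'rV[R]_n) : set 'rV[R]_n :=
  [set x | dot x u = 0].

Definition convex_body (R : realType) (n : nat) (K : set 'rV[R]_n) : Prop :=
  [/\ compact K, convex_set K & interior K !=set0].

Definition centered (R : realType) (n : nat) (K : set 'rV[R]_n) : Prop :=
  K = [set - x | x in K].

(* Lebesgue measures on R * R and (R * R) * R, as product measures on the
   product (hence Borel) sigma-algebras; only their values on Borel sets are
   meaningful. *)

Definition lebesgue2 (R : realType) : set (R * R) -> \bar R :=
  (@lebesgue_measure R \x @lebesgue_measure R)%E.

Definition lebesgue3 (R : realType) : set (R * R * R) -> \bar R :=
  ((@lebesgue_measure R \x @lebesgue_measure R) \x @lebesgue_measure R)%E.

Definition vec3 (R : realType) (p : R * R * R) : 'rV[R]_3 :=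
  \row_(i < 3) [:: p.1.1; p.1.2; p.2]`_i.

Definition volume (R : realType) (A : set 'rV[R]_3) : \bar R :=
  lebesgue3 (@vec3 R @^-1` A).

Definition perp_basis (R : realType) (u : 'rV[R]_3)
    (e : 'rV[R]_3 * 'rV[R]_3) : Prop :=
  [/\ perp u e.1, perp u e.2, enorm e.1 = 1, enorm e.2 = 1 & dot e.1 e.2 = 0].

(* Two-dimensional Lebesgue measure of a subset A of the plane u^\perp: the
   Lebesgue measure on R * R of the preimage of A under the linear isometry
   (s, t) |-> s e.1 + t e.2 onto u^\perp, where e is an orthonormal basis of
   u^\perp. Two such isometries differ by an orthogonal transformation of
   R * R, so the value on Borel sets does not depend on the e picked by xget. *)
Definition area_in_perp (R : realType) (u : 'rV[R]_3) (A : set 'rV[R]_3) :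
    \bar R :=
  let e := xget (0, 0) (perp_basis u) in
  lebesgue2 [set p : R * R | A (p.1 *: e.1 + p.2 *: e.2)].

(* The default value of xget in [area_in_perp] is never used when u is a unit
   vector. *)
Lemma perp_basis_exists (R : realType) (u : 'rV[R]_3) :
  unit_sphere u -> exists e, perp_basis u e.
Proof.
have dot3 (x y : 'rV[R]_3) : dot x y = x 0 0 * y 0 0 + x 0 1 * y 0 1
    + x 0 (Ordinal (isT : (2 < 3)%N)) * y 0 (Ordinal (isT : (2 < 3)%N)).
  rewrite /dot !big_ord_recl big_ord0 addr0 addrA.
  by congr (x 0 _ * y 0 _ + x 0 _ * y 0 _ + x 0 _ * y 0 _); apply: val_inj.
rewrite /unit_sphere /perp_basis /perp /enorm /= => u1.
have : dot u u = 1.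
  rewrite -(sqr_sqrtr (_ : 0 <= dot u u)) ?u1 ?expr1n//.
  by rewrite dot3; nra.
rewrite dot3 {u1}.
set a := u 0 0; set b := u 0 1; set c := u 0 _ => u1.
pose v (p : R * R * R) := vec3 p.
have [r0|r0] := eqVneq (a ^+ 2 + b ^+ 2) 0.
  have a0 : a = 0 by nra.
  have b0 : b = 0 by nra.
  exists (v (1, 0, 0), v (0, 1, 0)).
  rewrite !dot3 !mxE /= -/a -/b -/c a0 b0.
  by rewrite !(mul0r, mulr0, mul1r, addr0, add0r) sqrtr1.
have r_gt0 : 0 < a ^+ 2 + b ^+ 2 by rewrite lt_neqAle eq_sym r0 /=; nra.
pose r := Num.sqrt (a ^+ 2 + b ^+ 2).
have rn0 : r != 0 by rewrite gt_eqF// sqrtr_gt0.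
have r2 : r * r = a ^+ 2 + b ^+ 2 by rewrite -expr2 sqr_sqrtr// ltW.
have r2n0 : r * r != 0 by rewrite mulf_neq0.
exists (v (- b / r, a / r, 0), v (- (a * c) / r, - (b * c) / r, r)).
rewrite !dot3 !mxE /= -/a -/b -/c; split.
- by field.
- have -> : - (a * c) / r * a + - (b * c) / r * b + r * c
      = c * (r * r - (a ^+ 2 + b ^+ 2)) / r by field.
  by rewrite r2 subrr mulr0 mul0r.
- have -> : - b / r * (- b / r) + a / r * (a / r) + 0 * 0
      = (a ^+ 2 + b ^+ 2) / (r * r) by field.
  by rewrite -r2 divff// sqrtr1.
- have -> : - (a * c) / r * (- (a * c) / r) + - (b * c) / r * (- (b * c) / r)
      + r * r = c ^+ 2 * ((a ^+ 2 + b ^+ 2) / (r * r)) + r * r by field.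
  rewrite -{1}r2 divff// mulr1 r2.
  have -> : c ^+ 2 + (a ^+ 2 + b ^+ 2) = a * a + b * b + c * c by ring.
  by rewrite u1 sqrtr1.
- by field.
Qed.

(* Main.v *)
Require Import Defs.
From HB Require Import structures.
From mathcomp Require Import all_boot all_order all_algebra.
From mathcomp Require Import all_classical all_reals all_analysis.
From mathcomp Require Import measurable_realfun.
From mathcomp Require Import ring lra.

Set Implicit Arguments.
Unset Strict Implicit.
Unset Printing Implicit Defensive.

Import Order.TTheory GRing.Theory Num.Theory.
Import numFieldNormedType.Exports.

Local Open Scope classical_set_scope.
Local Open Scope ring_scope.

(** Why the theorem holds.  Let [K] be the body with the smaller sections and [L] the other
one.  The planes through the origin that do not contain the third axis are
[z = al x + be y]; give such a plane the weight
<<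
  w(be, al) = int_K h_s(z - al x - be y) dx dy dz,
  h_s(z) = (s^2 - z^2) / (s^2 + z^2)^2 = Re 1/(s + i z)^2,   s = e (1 + |be|),
>>
where [e > 0] is a parameter that will tend to [0].  Up to a constant, the limit of [w] is
the density that exhibits [1 / |.|_K] as a Radon transform, that is, [K] as an
intersection body; everything below happens at [e > 0], with nonnegative functions, so that
Tonelli's theorem, affine substitutions on the line and explicit primitives suffice.

Positivity of [w] (lemma [weight_ge0]).  The weight is the integral of [h_s] against the
areas of the sections of [K] parallel to the plane.  These areas decrease with the distance
to the origin because [K] is convex and symmetric ([parallel_section_le]); [h_s] is positive
for [|z| < s] and negative for [|z| > s], and its integral over [-M, M] is nonnegative
([integral_shifted_kernel_weighted]).

Summation over planes ([integral_pencil]).  Let [f(y)] be the integral of [w] over the pencil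
of planes that contain [y], divided by [|y1|].  For every measurable set [D] disjoint from
the plane [x = 0], the integral of [f] over [D] is the integral of [w] against the areas of the
central sections of [D], projected along the third axis.

Evaluation of [f].  The factor [1 + |be|] in [s] is chosen so that integrating [h_s] over the
pencil produces the product of two one-dimensional Poisson kernels
([integral_shifted_kernel]).  Hence [|y1| f(y)] is a Poisson average, of total mass [2 pi^2],
of the lengths of the chords of [K] parallel to [y] ([integral_weight_line]).  The central
chord is the longest one, and it has length at most [2 |y1|] in the first coordinate when
[y] is not in [K] and at least that when [y] is in [K].  So [f <= 4 pi^2] off [K]
([pencil_integral_outside]), and [f] is nearly at least [4 pi^2] on [K] when [e] is small
([pencil_integral_inside]).

Conclusion ([volume_le_of_sections]).  Cancelling the area of the section of the intersection
of [K] and [L], every central section of [K \ L] has at most the area of that of [L \ K].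
Integrating against [w >= 0] gives [int_(K \ L) f <= int_(L \ K) f], and the two bounds on [f] give
[vol(K \ L) <= vol(L \ K)] in the limit, hence [vol K <= vol L]. *)

(** * Tonelli and affine substitutions on the line *)

Section Basics.
Context {R : realType}.
Local Notation mu := (@lebesgue_measure R).

(** Reduces to the measurability of real powers, as [x^-1 = x * (x^2)^(-1)], even at [0]. *)
Lemma measurable_invr d (T : measurableType d) (f : T -> R) :
  measurable_fun setT f -> measurable_fun setT (fun x => (f x)^-1).
Proof.
move=> mf.
have -> : (fun x => (f x)^-1) = (fun x => f x * powR (f x ^+ 2) (-1)).
  apply/funext => x; rewrite powR_inv1 ?sqr_ge0//.
  have [->|fx0] := eqVneq (f x) 0; first by rewrite invr0 mul0r.
  by field.
apply: measurable_funM => //.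
apply: (measurableT_comp (f := fun y => powR y (-1))).
  exact: measurable_powR.
exact: measurable_funX.
Qed.

(** Both sides are measures that agree on half-open intervals. *)
Let affine_measure (c d : R) (c0 : c != 0) (A : set R) : measurable A ->
  mu A = (`|c|%:E * mu ((fun x => (c * x + d)%R) @^-1` A))%E.
Proof.
move=> mA.
have maff : measurable_fun [set: measurableTypeR R]
    (fun x => c * x + d : measurableTypeR R).
  by apply: measurable_funD => //; apply: measurable_funM.
pose k : {nonneg R} := NngNum (normr_ge0 c).
apply: (@lebesgue_measure_unique _
  (mscale k (pushforward mu (fun x => c * x + d : measurableTypeR R)))) => //=.
move=> _ [[a b]] _ <-.
change (mu `]a, b]%classic =
  `|c|%:E * mu ((fun x : R => (c * x + d)%R) @^-1` `]a, b]%classic))%E.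
have [c_lt0|c_gt0|/eqP] := ltgtP c 0; last by rewrite (negbTE c0).
- rewrite (_ : _ @^-1` _ = `[(b - d) / c, (a - d) / c[%classic); last first.
    apply/seteqP; split => x /=; rewrite !in_itv/= ler_ndivrMr// ltr_ndivlMr// => /andP[h1 h2];
    apply/andP; split; lra.
  rewrite !lebesgue_measure_itv/= !lte_fin ltr_ndivrMr// mulfVK// ltrD2r.
  case: ifPn => // _; last by rewrite mule0.
  rewrite -EFinB -EFinM; congr (_%:E).
  by rewrite ltr0_norm//; field.
- rewrite (_ : _ @^-1` _ = `](a - d) / c, (b - d) / c]%classic); last first.
    apply/seteqP; split => x /=; rewrite !in_itv/= ler_pdivlMr// ltr_pdivrMr// => /andP[h1 h2];
    apply/andP; split; lra.
  rewrite !lebesgue_measure_itv/= !lte_fin ltr_pdivlMr// mulfVK// ltrD2r.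
  case: ifPn => // _; last by rewrite mule0.
  rewrite -EFinB -EFinM; congr (_%:E).
  by rewrite gtr0_norm//; field.
Qed.

Lemma ge0_integral_affine (c d : R) (f : R -> \bar R) : c != 0 ->
  measurable_fun setT f -> (forall x, 0 <= f x)%E ->
  (\int[mu]_x f x = `|c|%:E * \int[mu]_x f (c * x + d)%R)%E.
Proof.
move=> c0 mf f0.
have maff : measurable_fun [set: measurableTypeR R]
    (fun x => c * x + d : measurableTypeR R).
  by apply: measurable_funD => //; apply: measurable_funM.
pose k : {nonneg R} := NngNum (normr_ge0 c).
have := @ge0_integral_pushforward _ _ _ _ _ _ maff mu setT f measurableT mf (fun y _ => f0 y).
rewrite preimage_setT /= => <-.
have := @ge0_integral_mscale _ _ _ (pushforward mu (fun x => c * x + d : measurableTypeR R)) setT measurableT k f mf (fun y _ => f0 y).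
move=> /(_ maff) /= <-.
apply: (@eq_measure_integral _ _ _ setT (mscale k
  (pushforward mu (fun x => c * x + d : measurableTypeR R)))) => //=.
by move=> A mA _; exact: affine_measure.
Qed.

Lemma ge0_integral_translate (d : R) (f : R -> \bar R) :
  measurable_fun setT f -> (forall x, 0 <= f x)%E ->
  (\int[mu]_x f (x + d)%R = \int[mu]_x f x)%E.
Proof.
move=> mf f0; rewrite [RHS](@ge0_integral_affine 1 d) ?oner_neq0// normr1 mul1e.
by under [in RHS]eq_integral do rewrite mul1r.
Qed.

Lemma measurable_ge0_integral d d' (T : measurableType d) (T' : measurableType d')
    (m : {sigma_finite_measure set T' -> \bar R}) (f : T -> T' -> \bar R) :
  measurable_fun setT (fun p : T * T' => f p.1 p.2) ->
  (forall x y, 0 <= f x y)%E ->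
  measurable_fun setT (fun x => (\int[m]_y f x y)%E).
Proof.
move=> mf f0.
exact: (measurable_fun_fubini_tonelli_F (fun p : T * T' => f p.1 p.2)).
Qed.

Lemma exchange_ge0_integral d d' (T : measurableType d) (T' : measurableType d')
    (m : {sigma_finite_measure set T -> \bar R})
    (m' : {sigma_finite_measure set T' -> \bar R}) (f : T -> T' -> \bar R) :
  measurable_fun setT (fun p : T * T' => f p.1 p.2) ->
  (forall x y, 0 <= f x y)%E ->
  (\int[m]_x \int[m']_y f x y = \int[m']_y \int[m]_x f x y)%E.
Proof.
move=> mf f0.
exact: (fubini_tonelli (fun p : T * T' => f p.1 p.2)).
Qed.

Lemma ge0_integral_prod d d' (T : measurableType d) (T' : measurableType d')
    (m : {sigma_finite_measure set T -> \bar R})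
    (m' : {sigma_finite_measure set T' -> \bar R}) (f : T -> T' -> \bar R) :
  measurable_fun setT (fun p : T * T' => f p.1 p.2) ->
  (forall x y, 0 <= f x y)%E ->
  (\int[m \x m']_p f p.1 p.2 = \int[m]_x \int[m']_y f x y)%E.
Proof.
move=> mf f0.
exact: (fubini_tonelli1 (fun p : T * T' => f p.1 p.2)).
Qed.

End Basics.

Section ProductMeasure.
Context d d' (T : measurableType d) (T' : measurableType d') {R : realType}
  (m : {sigma_finite_measure set T -> \bar R})
  (m' : {sigma_finite_measure set T' -> \bar R}).

Let sigma_finite_product : sigma_finite setT (m \x m')%E.
Proof.
have /sigma_finiteP[F [TF ndF Foo]] := sigma_finiteT m.
have /sigma_finiteP[G [TG ndG Goo]] := sigma_finiteT m'.
exists (fun n => F n `*` G n).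
  apply/seteqP; split => [[x y] _|//].
  have [n _ Fnx] : (\bigcup_n F n) x by rewrite -TF.
  have [k _ Gky] : (\bigcup_n G n) y by rewrite -TG.
  exists (maxn n k) => //; split => /=.
  - by move: x Fnx; exact/subsetPset/ndF/leq_maxl.
  - by move: y Gky; exact/subsetPset/ndG/leq_maxr.
move=> k; have [? ?] := Foo k; have [? ?] := Goo k.
split; first exact: measurableX.
by rewrite product_measure1E// lte_mul_pinfty// ge0_fin_numE.
Qed.

(** Packaged as a sigma-finite measure, so that Tonelli's theorem applies with a product measure as
    one of the factors. *)
Definition product_measure : {sigma_finite_measure set (T * T')%type -> \bar R} :=
  HB.pack (m \x m')%E
    (Measure_isSigmaFinite.Build _ _ _ (m \x m')%E sigma_finite_product).
End ProductMeasure.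

Section Meas.
Context {R : realType} d (T : measurableType d).
Implicit Types f g : T -> R.

Lemma measurable_add f g : measurable_fun setT f -> measurable_fun setT g ->
  measurable_fun setT (fun x => f x + g x).
Proof. exact: measurable_funD. Qed.
Lemma measurable_opp f : measurable_fun setT f ->
  measurable_fun setT (fun x => - f x).
Proof. exact: measurable_funN. Qed.
Lemma measurable_mul f g : measurable_fun setT f -> measurable_fun setT g ->
  measurable_fun setT (fun x => f x * g x).
Proof. exact: measurable_funM. Qed.
Lemma measurable_exp f n : measurable_fun setT f ->
  measurable_fun setT (fun x => f x ^+ n).
Proof. exact: measurable_funX. Qed.
Lemma measurable_normr f : measurable_fun setT f ->
  measurable_fun setT (fun x => `|f x|).
Proof. by move=> mf; exact: measurableT_comp. Qed.
Lemma measurable_EFin f : measurable_fun setT f ->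
  measurable_fun setT (fun x => (f x)%:E).
Proof. by move/measurable_EFinP. Qed.
Lemma measurable_mule (f g : T -> \bar R) :
  measurable_fun setT f -> measurable_fun setT g ->
  measurable_fun setT (fun x => f x * g x)%E.
Proof. exact: emeasurable_funM. Qed.
Lemma measurable_indic_comp d' (T' : measurableType d') (L : set T') (f : T -> T') :
  measurable L -> measurable_fun setT f ->
  measurable_fun setT (fun x => \1_L (f x) : R).
Proof.
by move=> mL mf; exact: (measurableT_comp (f := (\1_L : T' -> R)) (measurable_indic mL) mf).
Qed.
Lemma measurable_fst_comp d1 d2 (T1 : measurableType d1) (T2 : measurableType d2)
  (f : T -> T1 * T2) : measurable_fun setT f -> measurable_fun setT (fun x => (f x).1).
Proof. by move=> mf; apply: (measurableT_comp (f := fst)). Qed.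
Lemma measurable_snd_comp d1 d2 (T1 : measurableType d1) (T2 : measurableType d2)
  (f : T -> T1 * T2) : measurable_fun setT f -> measurable_fun setT (fun x => (f x).2).
Proof. by move=> mf; apply: (measurableT_comp (f := snd)). Qed.

Lemma measurable_pairl d1 d2 (T1 : measurableType d1) (T2 : measurableType d2) (x : T1) :
  measurable_fun setT (pair x : T2 -> T1 * T2).
Proof. exact: (measurable_fun_pair (f := cst x) (g := id)). Qed.

Lemma measurable_preimage d' (T' : measurableType d') (f : T -> T') (A : set T') :
  measurable_fun setT f -> measurable A -> measurable (f @^-1` A).
Proof. by move=> mf mA; rewrite -[X in measurable X]setTI; exact: mf. Qed.
End Meas.

(** Proves the measurability of functions built from projections, constants, arithmetic
    operations, pairing and indicators, by recursion on the body of the function. *)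
Ltac meas := lazymatch goal with
  | |- measurable_fun _ (fun x => (_ + _)%R) => apply: measurable_add; meas
  | |- measurable_fun _ (fun x => (- _)%R) => apply: measurable_opp; meas
  | |- measurable_fun _ (fun x => (_ * _)%R) => apply: measurable_mul; meas
  | |- measurable_fun _ (fun x => (_ * _)%E) => apply: measurable_mule; meas
  | |- measurable_fun _ (fun x => (_ ^+ _)%R) => apply: measurable_exp; meas
  | |- measurable_fun _ (fun x => (_ ^-1)%R) => apply: measurable_invr; meas
  | |- measurable_fun _ (fun x => `|_|%R) => apply: measurable_normr; meas
  | |- measurable_fun _ (fun x => (_)%:E) => apply: measurable_EFin; meas
  | |- measurable_fun _ (fun x => \1__ _) => apply: measurable_indic_comp; [try by []|meas]
  | |- measurable_fun _ (fun x => (_ , _)) => apply: measurable_fun_pair; meas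
  | |- measurable_fun _ (fun x => fst _) => apply: measurable_fst_comp; meas
  | |- measurable_fun _ (fun x => snd _) => apply: measurable_snd_comp; meas
  | |- measurable_fun _ (pair _) => exact: measurable_pairl
  | |- measurable_fun _ fst => exact: measurable_fst
  | |- measurable_fun _ snd => exact: measurable_snd
  | |- measurable_fun _ (fun x => x) => exact: measurable_id
  | |- _ => try by [exact: measurable_cst | assumption]
  end.


(** * Parallel sections of a symmetric convex set *)

Section Predicates.
Context {R : realType}.
Implicit Types C : set (R * R * R).

Definition convex3 C := forall t x y z x' y' z', 0 <= t <= 1 ->
  C (x, y, z) -> C (x', y', z') ->
  C (t * x + (1 - t) * x', t * y + (1 - t) * y', t * z + (1 - t) * z').

Definition symmetric3 C := forall x y z, C (x, y, z) -> C (- x, - y, - z).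

Definition bounded3 (M : R) C := forall x y z,
  C (x, y, z) -> [/\ `|x| <= M, `|y| <= M & `|z| <= M].
End Predicates.

Section Convex.
Context {R : realType}.
Local Notation mu := (@lebesgue_measure R).

Lemma lebesgue_measure_oppr (A : set R) : measurable A ->
  mu [set x | A (- x)] = mu A.
Proof. exact: lebesgue_measureN. Qed.

Lemma between_convex_comb (a b c : R) : a <= c <= b ->
  exists2 t, 0 <= t <= 1 & c = t * a + (1 - t) * b.
Proof.
move=> /andP[ac cb]; have [ab|ab] := eqVneq a b.
  exists 0; first by rewrite lexx ler01.
  by apply/eqP; rewrite mul0r add0r subr0 mul1r eq_le cb -ab ac.
have ba : 0 < b - a by rewrite subr_gt0 lt_neqAle ab (le_trans ac cb).
exists ((b - c) / (b - a)); last by field; rewrite gt_eqF.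
by rewrite divr_ge0 ?(ltW ba) ?subr_ge0//= ler_pdivrMr// mul1r; lra.
Qed.

(** The one-dimensional Brunn-Minkowski inequality, in the form needed for intervals: [S]
    contains the open interval whose endpoints are the combinations of the infima and of the
    suprema of [A] and [B]. *)
Lemma brunn_minkowski_interval (A B S : set R) (t M : R) :
  0 <= t <= 1 -> measurable A -> measurable B ->
  A !=set0 -> B !=set0 ->
  (forall x, A x -> `|x| <= M) -> (forall x, B x -> `|x| <= M) ->
  is_interval S ->
  (forall a b, A a -> B b -> S (t * a + (1 - t) * b)) ->
  (t%:E * mu A + (1 - t)%:E * mu B <= mu S)%E.
Proof.
move=> /andP[t0 t1] mA mB A0 B0 AM BM iS ABS.
have bnd (C : set R) : (forall x, C x -> `|x| <= M) -> C !=set0 ->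
    has_sup C /\ has_inf C.
  move=> CM C0; split; split => //.
    by exists M => x /CM; rewrite ler_norml => /andP[].
  by exists (- M) => x /CM; rewrite ler_norml => /andP[].
have leC (C : set R) : (forall x, C x -> `|x| <= M) -> C !=set0 -> measurable C ->
    (mu C <= (sup C - inf C)%:E)%E.
  move=> CM C0 mC; have [sC iC] := bnd C CM C0.
  have CI : C `<=` `[inf C, sup C]%classic.
    move=> x Cx; rewrite /= in_itv/=; apply/andP; split.
      exact: ge_inf iC.2 _ Cx.
    exact: ub_le_sup sC.2 _ Cx.
  apply: (@le_trans _ _ (mu `[inf C, sup C]%classic)).
    by apply: le_measure => //; rewrite inE.
  rewrite lebesgue_measure_itv/= lte_fin; case: ifPn => //.
  by move=> _; rewrite lee_fin subr_ge0; case: C0 => x /CI; rewrite /= in_itv/= => /andP[]; exact: le_trans.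
have [sA iA] := bnd A AM A0.
have [sB iB] := bnd B BM B0.
have sIA : inf A <= sup A by case: A0 => x Ax; apply: (le_trans (ge_inf iA.2 Ax)); exact: ub_le_sup sA.2 _ Ax.
have sIB : inf B <= sup B by case: B0 => x Bx; apply: (le_trans (ge_inf iB.2 Bx)); exact: ub_le_sup sB.2 _ Bx.
have t1' : 0 <= 1 - t by rewrite subr_ge0.
set l := t * inf A + (1 - t) * inf B.
set u := t * sup A + (1 - t) * sup B.
have luS : `]l, u[%classic `<=` S.
  move=> x /=; rewrite in_itv/= => /andP[lx xu].
  have xl : 0 < x - l by rewrite subr_gt0.
  have ux : 0 < u - x by rewrite subr_gt0.
  have [a Aa aP] := inf_adherent xl iA.
  have [b Bb bP] := inf_adherent xl iB.
  have [a' Aa' aP'] := sup_adherent ux sA.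
  have [b' Bb' bP'] := sup_adherent ux sB.
  apply: (iS _ _ (ABS _ _ Aa Bb) (ABS _ _ Aa' Bb')).
  rewrite /l in lx aP bP; rewrite /u in xu aP' bP'.
  by apply/andP; split; nra.
apply: (@le_trans _ _ (u - l)%:E).
  have -> : u - l = t * (sup A - inf A) + (1 - t) * (sup B - inf B) by rewrite /u/l; ring.
  by rewrite [leRHS]EFinD ![in leRHS]EFinM; apply: leeD; apply: lee_wpmul2l; rewrite ?lee_fin//; exact: leC.
have mS : measurable S by exact: is_interval_measurable.
apply: (@le_trans _ _ (mu `]l, u[%classic)).
  rewrite lebesgue_measure_itv/= lte_fin; case: ifPn => //.
  by rewrite lee_fin -leNgt subr_le0.
by apply: le_measure => //; rewrite inE.
Qed.

Variables (C : set (R * R * R)) (M : R).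
Hypothesis mC : measurable C.
Hypothesis C_convex : convex3 C.
Hypothesis C_sym : symmetric3 C.
Hypothesis C_bnd : bounded3 M C.

Let chord x z : set R := [set y | C (x, y, z)].
Let len x z := mu (chord x z).

Let m_chord x z : measurable (chord x z).
Proof. by apply: (measurable_preimage (f := fun y => (x, y, z))) => //; meas. Qed.

Let chord_interval x z : is_interval (chord x z).
Proof.
move=> a b Ca Cb c /andP[ac cb]; rewrite /chord/=.
have [|t t01 ->] := @between_convex_comb a b c; first by rewrite ac.
have := C_convex t01 Ca Cb.
have e w : t * w + (1 - t) * w = w by ring.
by rewrite !e.
Qed.

(** First use of Brunn-Minkowski: chord lengths in the second direction are concave. *)
Let len_concave t x z x' z' : 0 <= t <= 1 ->
  chord x z !=set0 -> chord x' z' !=set0 ->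
  (t%:E * len x z + (1 - t)%:E * len x' z' <=
   len (t * x + (1 - t) * x')%R (t * z + (1 - t) * z')%R)%E.
Proof.
move=> t01 c0 c0'; apply: (brunn_minkowski_interval (M := M)) => //.
- by move=> y /C_bnd[].
- by move=> y /C_bnd[].
- by move=> a b Ca Cb; exact: C_convex.
Qed.

Let len_even x z : len (- x) (- z) = len x z.
Proof.
rewrite /len -(lebesgue_measure_oppr (m_chord x z)); congr (mu _).
by apply/seteqP; split => y /= /C_sym; rewrite !opprK.
Qed.

Let len_fin x z : len x z \is a fin_num.
Proof.
rewrite ge0_fin_numE//.
apply: (@le_lt_trans _ _ (mu `[- M, M]%classic)).
  apply: le_measure; rewrite ?inE; [exact: m_chord|exact: measurable_itv|].
  by move=> y /= /C_bnd[_ + _]; rewrite ler_norml in_itv.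
by rewrite lebesgue_measure_itv/=; case: ifP => //; rewrite -EFinB ltry.
Qed.

Let level (s : R) z : set R := [set x | s%:E <= len x z]%E.

Let len_integral x z : len x z = (\int[mu]_y (\1_C (x, y, z))%:E)%E.
Proof.
rewrite /len -[chord _ _]setIT -integral_indic//; exact: m_chord.
Qed.

Let m_len : measurable_fun setT (fun p : R * R => len p.1 p.2).
Proof.
have h := @measurable_ge0_integral R _ _ _ _ mu
  (fun (p : R * R) y => (\1_C (p.1, y, p.2))%:E).
set F := fun _ => _; suff -> : F = fun p => (\int[mu]_y (\1_C (p.1, y, p.2))%:E)%E.
  by apply: h => //; meas.
by apply/funext => p; rewrite /F len_integral.
Qed.

Let m_level s z : measurable (level s z).
Proof.
have := @emeasurable_fun_c_infty _ _ R setT (fun x => len x z) measurableT.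
rewrite /level => /(_ _ s%:E); rewrite setTI; apply.
by apply: (measurableT_comp (g := fun x => (x, z)) m_len); meas.
Qed.

Let chord_level s x z : 0 < s -> level s z x -> chord x z !=set0.
Proof.
move=> s0 sl; apply/set0P; apply: contraPneq sl; rewrite /level/len/= => ->.
by rewrite measure0 lee_fin; apply/negP; rewrite -ltNge.
Qed.

Let level_combine s t x z x' z' : 0 < s -> 0 <= t <= 1 ->
  level s z x -> level s z' x' ->
  level s (t * z + (1 - t) * z') (t * x + (1 - t) * x').
Proof.
move=> s0 t01 sx sx'.
have := len_concave t01 (chord_level s0 sx) (chord_level s0 sx').
apply: le_trans; have -> : s = t * s + (1 - t) * s by ring.
case/andP: t01 => t0 t1.
by rewrite EFinD !EFinM; apply: leeD; apply: lee_wpmul2l; rewrite ?lee_fin ?subr_ge0.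
Qed.

Let level_interval s z : 0 < s -> is_interval (level s z).
Proof.
move=> s0 a b Ca Cb c /andP[ac cb].
have [|t t01 ->] := @between_convex_comb a b c; first by rewrite ac.
have := level_combine s0 t01 Ca Cb.
by have -> : t * z + (1 - t) * z = z by ring.
Qed.

(** Second use of Brunn-Minkowski.  As [z'] is a convex combination of [z] and [- z], the level
    set at [z'] contains the corresponding combination of the level set at [z] and of its
    mirror image, which have the same measure. *)
Let level_le s z z' : 0 < s -> `|z'| <= `|z| ->
  (mu (level s z) <= mu (level s z'))%E.
Proof.
move=> s0 zz'.
have [->|lz0] := eqVneq (level s z) set0; first by rewrite measure0.
have {}lz0 : level s z !=set0 by exact/set0P.
have levelN : level s (- z) = [set x | level s z (- x)].
  by apply/seteqP; split=> x; rewrite /level/= -len_even opprK.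
have [t t01 tz] : exists2 t, 0 <= t <= 1 & z' = t * z + (1 - t) * (- z).
  have [z0|z0] := eqVneq z 0.
    move: zz'; rewrite z0 normr0 normr_le0 => /eqP ->.
    by exists 0; [rewrite lexx ler01|rewrite oppr0 !mulr0 addr0].
  exists ((1 + z' / z) / 2); last by field.
  have : `|z' / z| <= 1 by rewrite normrM normfV ler_pdivrMr ?normr_gt0// mul1r.
  by rewrite ler_norml => /andP[h1 h2]; apply/andP; split; lra.
have lb : (t%:E * mu (level s z) + (1 - t)%:E * mu (level s (- z)) <= mu (level s z'))%E.
  apply: (brunn_minkowski_interval (M := M)) => //.
  - case: lz0 => x lx; exists (- x); rewrite levelN /= opprK//.
  - by move=> x /(chord_level s0)[y /C_bnd[]].
  - by move=> x /(chord_level s0)[y /C_bnd[]].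
  - exact: level_interval.
  - by move=> a b la lb; rewrite tz; exact: level_combine.
move: lb; rewrite levelN (lebesgue_measure_oppr (m_level _ _)) -ge0_muleDl; last 2 first.
  by rewrite lee_fin; case/andP: t01.
  by rewrite lee_fin subr_ge0; case/andP: t01.
by rewrite -EFinD addrC subrK mul1e.
Qed.

Let E := [set p : R * R * R | 0 < p.1.1 /\ ((p.1.1)%:E <= len p.1.2 p.2)%E].

(** Layer cake formula for the chord length. *)
Let len_layer_cake x z : len x z = (\int[mu]_s (\1_E (s, x, z))%:E)%E.
Proof.
have -> : (\int[mu]_s (\1_E (s, x, z))%:E)%E = (\int[mu]_s (\1_(`]0, fine (len x z)]%classic) s)%:E)%E.
  apply: eq_integral => s _; congr (_%:E); rewrite !indicE; congr ((_ : bool)%:R).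
  apply/idP/idP; rewrite !inE /E/= in_itv/=.
    by move=> [s0 sl]; rewrite s0/= -lee_fin fineK.
  by move=> /andP[s0 sl]; split => //; rewrite -(fineK (len_fin x z)) lee_fin.
transitivity (mu `]0, fine (len x z)]%classic); last by rewrite integral_indic// setIT.
rewrite lebesgue_measure_itv/= lte_fin.
case: ifPn => [|]; first by rewrite oppr0 adde0 fineK.
rewrite -leNgt => l0; apply/eqP; rewrite eq_le measure_ge0 andbT.
by rewrite -(fineK (len_fin x z)) lee_fin.
Qed.

(** The area of a section is the integral over the levels [s > 0] of the measures of the level
    sets of the chord length, and each of these decreases with [`|z|] by [level_le].  This
    replaces the planar Brunn-Minkowski inequality by its one-dimensional case. *)
Lemma parallel_section_le z z' : `|z'| <= `|z| ->
  (\int[mu]_x \int[mu]_y (\1_C (x, y, z))%:E <= \int[mu]_x \int[mu]_y (\1_C (x, y, z'))%:E)%E.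
Proof.
move=> zz'.
have mE : measurable E.
  apply: measurableI.
    rewrite -[X in measurable X]setTI.
    have := @emeasurable_fun_o_infty _ _ R setT (fun p : R * R * R => p.1.1%:E) measurableT.
    by move=> /(_ _ 0%E); apply; meas.
  rewrite -[X in measurable X]setTI.
  apply: (emeasurable_fun_le measurableT); first by meas.
  apply: (measurableT_comp (g := fun p : R * R * R => (p.1.2, p.2)) m_len); meas.
have AE w : (\int[mu]_x \int[mu]_y (\1_C (x, y, w))%:E =
    \int[mu]_s \int[mu]_x (\1_E (s, x, w))%:E)%E.
  transitivity (\int[mu]_x \int[mu]_s (\1_E (s, x, w))%:E)%E.
    apply: eq_integral => x _; rewrite -len_layer_cake.
    by rewrite len_integral.
  by apply: exchange_ge0_integral => //; meas.
rewrite !AE; apply: ge0_le_integral => //.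
- by move=> s _; exact: integral_ge0.
- apply: (@measurable_ge0_integral R _ _ _ _ mu (fun s x => (\1_E (s, x, z))%:E)) => //; meas.
- apply: (@measurable_ge0_integral R _ _ _ _ mu (fun s x => (\1_E (s, x, z'))%:E)) => //; meas.
move=> s _; have [s0|s0] := ltP 0 s; last first.
  rewrite integral0_eq ?integral_ge0// => x _.
  by rewrite indicE memNset//= => -[]; rewrite ltNge s0.
have Ew w : (\int[mu]_x (\1_E (s, x, w))%:E)%E = mu (level s w).
  rewrite integral_indic ?setIT//.
    congr (mu _); apply/seteqP; split => x /=; first by case.
    by [].
  by apply: (measurable_preimage (f := fun x => (s, x, w))) => //; meas.
by rewrite !Ew; exact: level_le.
Qed.
End Convex.

(** * The kernels and their integrals *)

Section Kernels.
Context {R : realType}.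
Local Notation mu := (@lebesgue_measure R).

Lemma is_derive_continuous (f : R -> R) (x df : R) :
  is_derive x 1 f df -> {for x, continuous f}.
Proof.
by move=> fx; apply: differentiable_continuous; apply/derivable1_diffP; exact: ex_derive.
Qed.

Lemma integral_segment_FTC (f F df : R -> R) (a b : R) : a < b ->
  (forall x : R, is_derive x 1 F (f x)) -> (forall x : R, is_derive x 1 f (df x)) ->
  (\int[mu]_(x in `[a, b]) (f x)%:E = (F b - F a)%:E)%E.
Proof.
move=> ab dF df'.
have cF x : {for x, continuous F} by exact: is_derive_continuous (dF x).
rewrite (@continuous_FTC2 _ f F)//.
- by apply: continuous_in_subspaceT => x _; exact: is_derive_continuous (df' x).
- split.
  + by move=> x _; exact: ex_derive.
  + by apply: cvg_at_right_filter; exact: cF.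
  + by apply: cvg_at_left_filter; exact: cF.
- by move=> x _; rewrite derive1E; exact: derive_val.
Qed.

(** Differentiability on an open half-line containing [a] spares the one-sided conditions at
    [a]. *)
Lemma ge0_integral_halfline_FTC (f F df : R -> R) (c a l : R) : c < a ->
  (forall x : R, c < x -> is_derive x 1 F (f x)) ->
  (forall x : R, c < x -> is_derive x 1 f (df x)) ->
  (forall x, a <= x -> 0 <= f x) -> F x @[x --> +oo%R] --> (l : R) ->
  (\int[mu]_(x in `[a, +oo[) (f x)%:E = (l - F a)%:E)%E.
Proof.
move=> ca dF df' f0 Fl.
have cf x : c < x -> {for x, continuous f}.
  by move=> cx; exact: is_derive_continuous (df' x cx).
rewrite (@ge0_continuous_FTC2y _ f F a l)//.
- apply/continuous_within_itvcyP; split.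
    by move=> x; rewrite in_itv/= andbT => ax; apply: cf; exact: lt_trans ax.
  by apply: cvg_at_right_filter; exact: cf.
- by move=> x ax; have ? := dF x (lt_trans ca ax); exact: ex_derive.
- by apply: cvg_at_right_filter; exact: is_derive_continuous (dF a ca).
- move=> x; rewrite in_itv/= andbT => ax.
  by rewrite derive1E; have := dF x (lt_trans ca ax) => ?; exact: derive_val.
Qed.

Lemma ge0_integral_fold (f : R -> \bar R) :
  measurable_fun setT f -> (forall x, 0 <= f x)%E ->
  (\int[mu]_x f x = \int[mu]_(x in `[0%R, +oo[) f x + \int[mu]_(x in `[0%R, +oo[) f (- x)%R)%E.
Proof.
move=> mf f0.
rewrite (@ge0_integration_by_substitution0 _ (fun x => f (- x)))//; last first.
  by apply: measurableT_comp.
under [X in (_ + X)%E]eq_integral do rewrite opprK.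
rewrite (_ : [set: R] = `[0, +oo[%classic `|` `]-oo, 0[%classic); last first.
  by apply/seteqP; split => x //= _; rewrite !in_itv/= andbT; case: (leP 0 x); [left|right].
rewrite ge0_integral_setU//=.
- congr (_ + _)%E; apply: integral_itv_bndo_bndc.
  exact: measurable_funTS.
- exact: measurable_funTS.
- by apply/disj_setPS => x /= [] /[!in_itv]/=; rewrite andbT leNgt => /negbTE ->.
Qed.

Variable e : R.
Hypothesis e0 : 0 < e.

(** The scale [s] of the kernel for the planes with slope [be] in the second direction. *)
Definition width (be : R) : R := e * (1 + `|be|).
(** A bound on the absolute value of [plane_kernel (width be)], added to it to make it nonnegative, so
    that only integrals of nonnegative functions are exchanged. *)
Definition kernel_shift (be : R) : R := ((width be) ^+ 2)^-1.
(** The real part of [1 / (s + i z)^2]. *)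
Definition plane_kernel (s z : R) : R := (s ^+ 2 - z ^+ 2) / (s ^+ 2 + z ^+ 2) ^+ 2.
Definition shifted_kernel (be z : R) : R := plane_kernel (width be) z + kernel_shift be.
(** Up to normalization, the product of the Poisson kernels of the half-plane at height [e]. *)
Definition poisson_kernel (a b : R) : R :=
  2 * ((e / (e ^+ 2 + a ^+ 2)) * (e / (e ^+ 2 + b ^+ 2))).

Lemma width_gt0 be : 0 < width be.
Proof. by rewrite /width mulr_gt0// ltr_pwDl. Qed.

Lemma sqr_add_gt0 (s z : R) : 0 < s -> 0 < s ^+ 2 + z ^+ 2.
Proof. by move=> s0; rewrite ltr_pwDl ?exprn_gt0// sqr_ge0. Qed.

Lemma plane_kernel_ge0 (s z : R) : 0 < s -> `|z| <= s -> 0 <= plane_kernel s z.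
Proof.
move=> s0 zs; rewrite /plane_kernel divr_ge0 ?exprn_ge0 ?(ltW (sqr_add_gt0 _ _))// subr_ge0.
by rewrite -(real_normK (num_real z)) lerXn2r// nnegrE ?normr_ge0// ltW.
Qed.

Lemma plane_kernel_le0 (s z : R) : 0 < s -> s <= `|z| -> plane_kernel s z <= 0.
Proof.
move=> s0 zs; rewrite /plane_kernel pmulr_lle0 ?invr_gt0 ?exprn_gt0 ?sqr_add_gt0// subr_le0.
by rewrite -(real_normK (num_real z)) lerXn2r// nnegrE ?normr_ge0// ltW.
Qed.

Lemma abs_plane_kernel (s z : R) : 0 < s -> `|plane_kernel s z| <= (s ^+ 2)^-1.
Proof.
move=> s0; have D0 := sqr_add_gt0 z s0; have s20 : 0 < s ^+ 2 by rewrite exprn_gt0.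
have z20 := sqr_ge0 z.
rewrite /plane_kernel normrM normfV (gtr0_norm (x := (s ^+ 2 + z ^+ 2) ^+ 2)) ?exprn_gt0//.
rewrite ler_pdivrMr ?exprn_gt0// ler_pdivlMl//.
have hN : `|s ^+ 2 - z ^+ 2| <= s ^+ 2 + z ^+ 2.
  by rewrite ler_norml; apply/andP; split; lra.
by rewrite [leRHS]expr2; apply: ler_pM; rewrite ?sqr_ge0 ?normr_ge0 ?lerDl.
Qed.

Lemma shifted_kernel_ge0 be z : 0 <= shifted_kernel be z.
Proof.
have := abs_plane_kernel z (width_gt0 be); rewrite ler_norml => /andP[h _].
by rewrite /shifted_kernel /kernel_shift; lra.
Qed.

Lemma kernel_shift_ge0 be : 0 <= kernel_shift be.
Proof. by rewrite /kernel_shift invr_ge0 sqr_ge0. Qed.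

Lemma is_derive_plane_kernel_primitive (s c x : R) : 0 < s ->
  is_derive x 1 (fun z => z / (s ^+ 2 + z ^+ 2) + c * z) (plane_kernel s x + c).
Proof.
move=> s0; have D0 : s ^+ 2 + x ^+ 2 != 0 by rewrite gt_eqF// sqr_add_gt0.
apply: is_derive_eq; rewrite /plane_kernel /GRing.scale/=; field.
by rewrite D0.
Qed.

Lemma derivable_plane_kernel (s c x : R) : 0 < s ->
  derivable (fun z => plane_kernel s z + c) x 1.
Proof.
move=> s0; have D0 : (s ^+ 2 + x ^+ 2) ^+ 2 != 0.
  by rewrite expf_neq0// gt_eqF// sqr_add_gt0.
by rewrite /plane_kernel; apply: ex_derive.
Qed.

Lemma integral_plane_kernel_segment (s c M : R) : 0 < s -> 0 < M ->
  (\int[mu]_(z in `[(- M)%R, M]) (plane_kernel s z + c)%:E =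
    (2 * (M / (s ^+ 2 + M ^+ 2)) + 2 * (c * M))%:E)%E.
Proof.
move=> s0 M0; have MM : - M < M by lra.
rewrite (integral_segment_FTC MM (fun x => is_derive_plane_kernel_primitive c x s0)
  (fun x => derivableP (@derivable_plane_kernel s c x s0))).
by congr (_%:E); rewrite sqrrN mulNr mulrN; ring.
Qed.

Lemma integral_shifted_kernel_segment (be M : R) : 0 < M ->
  (\int[mu]_(z in `[(- M)%R, M]) (kernel_shift be)%:E <= \int[mu]_(z in `[(- M)%R, M]) (shifted_kernel be z)%:E)%E.
Proof.
move=> M0; have s0 := width_gt0 be.
have -> : (\int[mu]_(z in `[(- M)%R, M]) (kernel_shift be)%:E = (2 * (kernel_shift be * M))%:E)%E.
  rewrite integral_cst//= lebesgue_measure_itv/= lte_fin; case: ifPn => [_|/negP[]]; last by lra.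
  by rewrite -EFinB -EFinM; congr (_%:E); ring.
rewrite /shifted_kernel integral_plane_kernel_segment// lee_fin lerDr mulr_ge0// divr_ge0// ltW//.
exact: sqr_add_gt0.
Qed.

End Kernels.

Section KernelLines.
Context {R : realType}.
Local Notation mu := (@lebesgue_measure R).
Variable e : R.
Hypothesis e0 : 0 < e.

(** A primitive on [be > -1] of the shifted kernel along a pencil.  For [be >= 0] the kernel at
    [b - be a] is the real part of [1 / (p + be q)^2] with [p = e + i b] and [q = e - i a]; the
    first term is the real part of [- 1 / (q (p + be q))]. *)
Let primitive (a b be : R) : R :=
  - ((e * (e * (1 + be)) + a * (b - be * a)) *
     ((e ^+ 2 + a ^+ 2) * ((e * (1 + be)) ^+ 2 + (b - be * a) ^+ 2))^-1)
  - (e ^+ 2 * (1 + be))^-1.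

Let is_derive_primitive (a b x : R) : -1 < x ->
  is_derive x 1 (primitive a b)
    (plane_kernel (e * (1 + x)) (b - x * a) + ((e * (1 + x)) ^+ 2)^-1).
Proof.
move=> x1; have x0 : 0 < 1 + x by lra.
have s0 : 0 < e * (1 + x) by rewrite mulr_gt0.
have D0 : (e * (1 + x)) ^+ 2 + (b - x * a) ^+ 2 != 0 by rewrite gt_eqF// sqr_add_gt0.
have c0 : e ^+ 2 + a ^+ 2 != 0 by rewrite gt_eqF// sqr_add_gt0.
have cD0 : (e ^+ 2 + a ^+ 2) * ((e * (1 + x)) ^+ 2 + (b - x * a) ^+ 2) != 0 by rewrite mulf_neq0.
have e20 : e ^+ 2 * (1 + x) != 0 by rewrite mulf_neq0// ?expf_neq0 ?gt_eqF.
rewrite /primitive; apply: is_derive_eq; rewrite /plane_kernel /GRing.scale/=. field.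
by rewrite D0 c0 !gt_eqF.
Qed.

Let derivable_halfline (a b x : R) : -1 < x ->
  derivable (fun x : R => plane_kernel (e * (1 + x)) (b - x * a) + ((e * (1 + x)) ^+ 2)^-1) x 1.
Proof.
move=> x1; have x0 : 0 < 1 + x by lra.
have s0 : 0 < e * (1 + x) by rewrite mulr_gt0.
have D0 : ((e * (1 + x)) ^+ 2 + (b - x * a) ^+ 2) ^+ 2 != 0 by rewrite expf_neq0// gt_eqF// sqr_add_gt0.
have s20 : (e * (1 + x)) ^+ 2 != 0 by rewrite expf_neq0// gt_eqF.
by rewrite /plane_kernel; apply: ex_derive.
Qed.

Let primitive_bound (a b x : R) : 0 <= x -> `|primitive a b x| <= 3 / (e ^+ 2 * (1 + x)).
Proof.
move=> x0; have s0 : 0 < e * (1 + x) by rewrite mulr_gt0//; lra.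
rewrite /primitive; set s := e * (1 + x) in s0 *; set z := b - x * a.
have D0 : 0 < s ^+ 2 + z ^+ 2 by exact: sqr_add_gt0.
have c0 : 0 < e ^+ 2 + a ^+ 2 by exact: sqr_add_gt0.
have es : e ^+ 2 * (1 + x) = e * s by rewrite /s; ring.
have es0 : 0 < e * s by rewrite mulr_gt0.
rewrite es -opprD normrN; apply: (le_trans (ler_normD _ _)).
have -> : 3 / (e * s) = 2 / (e * s) + (e * s)^-1 by field; rewrite gt_eqF// gt_eqF.
apply: lerD; last by rewrite gtr0_norm ?invr_gt0.
rewrite normrM normfV (gtr0_norm (mulr_gt0 c0 D0)) ler_pdivrMr ?mulr_gt0// mulrAC ler_pdivlMr//.
have h1 : e * s * (e * s) <= (e ^+ 2 + a ^+ 2) * (s ^+ 2 + z ^+ 2).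
  by have := sqr_ge0 (e * z); have := sqr_ge0 (a * s); have := sqr_ge0 (a * z); nra.
have h2 : `|a * z| * (e * s) <= (e ^+ 2 + a ^+ 2) * (s ^+ 2 + z ^+ 2).
  rewrite -[e * s]gtr0_norm// -normrM ler_norml; apply/andP; split.
    have := sqr_ge0 (e * s + a * z); have := sqr_ge0 (e * z); have := sqr_ge0 (a * s); nra.
  have := sqr_ge0 (e * s - a * z); have := sqr_ge0 (e * z); have := sqr_ge0 (a * s); nra.
apply: (@le_trans _ _ ((`|e * s| + `|a * z|) * (e * s))).
  by apply: ler_wpM2r; [exact: ltW|exact: ler_normD].
by rewrite gtr0_norm//; lra.
Qed.

Let primitive_cvg (a b : R) : primitive a b x @[x --> +oo%R] --> (0 : R).
Proof.
apply/cvgr0Pnorm_lt => d d0; near=> x.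
have x0 : 0 <= x by near: x; exact: nbhs_pinfty_ge.
apply: (le_lt_trans (primitive_bound _ _ x0)).
have e20 : 0 < e ^+ 2 by rewrite exprn_gt0.
rewrite ltr_pdivrMr ?mulr_gt0//; last lra.
have de := mulr_gt0 d0 e20.
have : 3 / (d * e ^+ 2) < x by near: x; apply: nbhs_pinfty_gt; exact: num_real.
rewrite ltr_pdivrMr ?mulr_gt0//; nra.
Unshelve. all: by end_near. Qed.

Let integral_shifted_kernel_halfline (a b : R) :
  (\int[mu]_(x in `[0%R, +oo[) (plane_kernel (e * (1 + x)) (b - x * a) + ((e * (1 + x)) ^+ 2)^-1)%:E
   = ((e ^+ 2 + a * b) / ((e ^+ 2 + a ^+ 2) * (e ^+ 2 + b ^+ 2)) + (e ^+ 2)^-1)%:E)%E.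
Proof.
have N10 : -1 < 0 :> R by lra.
rewrite (ge0_integral_halfline_FTC N10 (@is_derive_primitive a b)
  (fun x x1 => derivableP (@derivable_halfline a b x x1)) _ (primitive_cvg a b)).
  congr (_%:E); rewrite /primitive; rewrite !(addr0, mulr1, mul0r, subr0).
  by rewrite sub0r opprB opprK addrC; congr (_ * _ + _); ring.
move=> x x0; have s0 : 0 < e * (1 + x) by rewrite mulr_gt0//; lra.
have := abs_plane_kernel (b - x * a) s0; rewrite ler_norml => /andP[h _]; lra.
Qed.

Lemma measurable_shifted_kernel d (T : measurableType d) (f g : T -> R) :
  measurable_fun setT f -> measurable_fun setT g ->
  measurable_fun setT (fun x => shifted_kernel e (f x) (g x)).
Proof. by move=> mf mg; rewrite /shifted_kernel /plane_kernel /kernel_shift /width; meas. Qed.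

Lemma measurable_kernel_shift d (T : measurableType d) (f : T -> R) :
  measurable_fun setT f -> measurable_fun setT (fun x => kernel_shift e (f x)).
Proof. by move=> mf; rewrite /kernel_shift /width; meas. Qed.

Lemma measurable_poisson_kernel d (T : measurableType d) (f g : T -> R) :
  measurable_fun setT f -> measurable_fun setT g ->
  measurable_fun setT (fun x => poisson_kernel e (f x) (g x)).
Proof. by move=> mf mg; rewrite /poisson_kernel; meas. Qed.

Lemma poisson_kernel_ge0 (a b : R) : 0 <= poisson_kernel e a b.
Proof.
by rewrite /poisson_kernel mulr_ge0// mulr_ge0// divr_ge0// ltW// sqr_add_gt0.
Qed.

(** The half-lines [be >= 0] and [be <= 0] contribute [Re 1 / ((e + i b) (e - i a))] and
    [Re 1 / ((e + i b) (e + i a))], whose sum is the product of Poisson kernels; the shift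
    contributes [2 / e^2].  The width [e (1 + |be|)] is what makes the integrand on each half-line
    the real part of the inverse square of an affine function. *)
Lemma integral_shifted_kernel (a b : R) :
  (\int[mu]_x (shifted_kernel e x (b - x * a))%:E = (poisson_kernel e a b + 2 / e ^+ 2)%:E)%E.
Proof.
rewrite ge0_integral_fold; last 2 first.
- by apply: measurable_EFin; apply: measurable_shifted_kernel; meas.
- by move=> x; rewrite lee_fin shifted_kernel_ge0.
have -> : (\int[mu]_(x in `[0%R, +oo[) (shifted_kernel e x (b - x * a))%:E =
    ((e ^+ 2 + a * b) / ((e ^+ 2 + a ^+ 2) * (e ^+ 2 + b ^+ 2)) + (e ^+ 2)^-1)%:E)%E.
  rewrite -integral_shifted_kernel_halfline; apply: eq_integral => x.
  by rewrite inE/= in_itv/= andbT => x0; rewrite /shifted_kernel/kernel_shift/width ger0_norm.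
have -> : (\int[mu]_(x in `[0%R, +oo[) (shifted_kernel e (- x) (b - - x * a))%:E =
    ((e ^+ 2 + (- a) * b) / ((e ^+ 2 + (- a) ^+ 2) * (e ^+ 2 + b ^+ 2)) + (e ^+ 2)^-1)%:E)%E.
  rewrite -integral_shifted_kernel_halfline; apply: eq_integral => x.
  by rewrite inE/= in_itv/= andbT => x0; rewrite /shifted_kernel/kernel_shift/width normrN ger0_norm// mulrN mulNr.
have e2 : e != 0 by rewrite gt_eqF.
have a0 : e ^+ 2 + a ^+ 2 != 0 by rewrite gt_eqF// sqr_add_gt0.
have b0 : e ^+ 2 + b ^+ 2 != 0 by rewrite gt_eqF// sqr_add_gt0.
rewrite -EFinD; congr (_%:E); rewrite /poisson_kernel sqrrN; field.
by rewrite e2 a0 b0.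
Qed.

Lemma integral_kernel_shift : (\int[mu]_x (kernel_shift e x)%:E = (2 / e ^+ 2)%:E)%E.
Proof.
rewrite ge0_integral_fold; last 2 first.
- by apply: measurable_EFin; apply: measurable_kernel_shift; meas.
- by move=> x; rewrite lee_fin kernel_shift_ge0.
have half : (\int[mu]_(x in `[0%R, +oo[) (((e * (1 + x)) ^+ 2)^-1)%:E = ((e ^+ 2)^-1)%:E)%E.
  have N10 : -1 < 0 :> R by lra.
  have dF (x : R) : -1 < x ->
      is_derive x 1 (fun x : R => - (e ^+ 2 * (1 + x))^-1) ((e * (1 + x)) ^+ 2)^-1.
    move=> x1; have x0 : 0 < 1 + x by lra.
    have e20 : e ^+ 2 * (1 + x) != 0 by rewrite mulf_neq0// ?expf_neq0 ?gt_eqF.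
    apply: is_derive_eq; rewrite /GRing.scale/=; field.
    by rewrite !gt_eqF.
  have df (x : R) : -1 < x -> derivable (fun x : R => ((e * (1 + x)) ^+ 2)^-1) x 1.
    move=> x1; have x0 : 0 < 1 + x by lra.
    have s20 : (e * (1 + x)) ^+ 2 != 0 by rewrite expf_neq0// mulf_neq0// gt_eqF.
    exact: ex_derive.
  rewrite (ge0_integral_halfline_FTC N10 dF (fun x x1 => derivableP (df x x1)) (l := 0)).
  - by rewrite sub0r opprK addr0 mulr1.
  - by move=> x _; rewrite invr_ge0 sqr_ge0.
  apply/cvgr0Pnorm_lt => d d0; near=> x.
  have x0 : 0 <= x by near: x; exact: nbhs_pinfty_ge.
  have e20 : 0 < e ^+ 2 by rewrite exprn_gt0.
  have x10 : 0 < 1 + x by lra.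
  have de := mulr_gt0 d0 e20.
  rewrite normrN gtr0_norm ?invr_gt0 ?mulr_gt0// -[X in X < _]div1r ltr_pdivrMr ?mulr_gt0//.
  have : 1 / (d * e ^+ 2) < x by near: x; apply: nbhs_pinfty_gt; exact: num_real.
  by rewrite ltr_pdivrMr//; nra.
have -> : (\int[mu]_(x in `[0%R, +oo[) (kernel_shift e x)%:E = ((e ^+ 2)^-1)%:E)%E.
  rewrite -half; apply: eq_integral => x.
  by rewrite inE/= in_itv/= andbT => x0; rewrite /kernel_shift/width ger0_norm.
have -> : (\int[mu]_(x in `[0%R, +oo[) (kernel_shift e (- x))%:E = ((e ^+ 2)^-1)%:E)%E.
  rewrite -half; apply: eq_integral => x.
  by rewrite inE/= in_itv/= andbT => x0; rewrite /kernel_shift/width normrN ger0_norm.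
by rewrite -EFinD; congr (_%:E); ring.
Unshelve. all: by end_near. Qed.

Lemma integral_cauchy_segment (t : R) : 0 < t ->
  (\int[mu]_(a in `[(- t)%R, t]) (e / (e ^+ 2 + a ^+ 2))%:E = (2 * atan (t / e))%:E)%E.
Proof.
move=> t0; have tt : - t < t by lra.
have dF (x : R) : is_derive x 1 (fun a : R => atan (e^-1 * a)) (e / (e ^+ 2 + x ^+ 2)).
  have D0 : e ^+ 2 + x ^+ 2 != 0 by rewrite gt_eqF// sqr_add_gt0.
  have d1 := is_derive1_atan (e^-1 * x).
  have d2 : is_derive x 1 (fun a : R => e^-1 * a) e^-1.
    by apply: is_derive_eq; rewrite /GRing.scale/= ?(mulr0,mulr1,addr0,add0r).
  apply: (is_derive_eq (is_derive1_comp d1 d2)).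
  field; rewrite D0 gt_eqF//=.
have df (x : R) : derivable (fun a : R => e / (e ^+ 2 + a ^+ 2)) x 1.
  have D0 : e ^+ 2 + x ^+ 2 != 0 by rewrite gt_eqF// sqr_add_gt0.
  exact: ex_derive.
rewrite (integral_segment_FTC tt dF (fun x => derivableP (df x))).
by congr (_%:E); rewrite mulrN atanN mulrC; ring.
Qed.

Lemma integral_cauchy : (\int[mu]_a (e / (e ^+ 2 + a ^+ 2))%:E = pi%:E)%E.
Proof.
have mc : measurable_fun setT (fun a : R => (e / (e ^+ 2 + a ^+ 2))%:E) by meas.
have c0 (a : R) : (0 <= (e / (e ^+ 2 + a ^+ 2))%:E)%E.
  by rewrite lee_fin divr_ge0// ltW// sqr_add_gt0.
rewrite (ge0_integral_affine 0 (_ : e != 0) mc c0) ?gt_eqF// gtr0_norm//.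
rewrite -ge0_integralZl; [|exact: measurableT|by meas|by move=> x _; exact: c0|by rewrite lee_fin ltW].
have E1 x : (e%:E * (e / (e ^+ 2 + (e * x + 0) ^+ 2))%:E)%E = ((oneDsqr x)^-1)%:E.
  rewrite -EFinM; congr (_%:E); rewrite addr0 /oneDsqr exprMn.
  have o : 1 + x ^+ 2 != 0 by rewrite gt_eqF// ltr_pwDl ?sqr_ge0.
  have -> : e ^+ 2 + e ^+ 2 * x ^+ 2 = e ^+ 2 * (1 + x ^+ 2) by ring.
  by field; rewrite o gt_eqF.
under eq_integral do rewrite E1.
rewrite ge0_integral_fold; last 2 first.
- by rewrite /oneDsqr; meas.
- by move=> x; rewrite lee_fin invr_ge0.
have E2 x : ((oneDsqr (- x))^-1)%:E = ((oneDsqr x)^-1)%:E :> \bar R by rewrite /oneDsqr sqrrN.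
under [X in (_ + X)%E]eq_integral do rewrite E2.
by rewrite !integral0y_oneDsqr -EFinD; congr (_%:E); lra.
Qed.
End KernelLines.

Section WeightedSection.
Context {R : realType}.
Local Notation mu := (@lebesgue_measure R).
Variable e : R.
Hypothesis e0 : 0 < e.

(** This says that [plane_kernel] has a nonnegative integral against [A].  With [s] the width,
    [plane_kernel s z * (A z - A s)] is nonnegative for every [z], since both factors change sign
    at [|z| = s], and the integral of [plane_kernel s] over [- M, M] is nonnegative. *)
Lemma integral_shifted_kernel_weighted (be M : R) (A : R -> \bar R) : 0 < M ->
  measurable_fun setT A -> (forall z, 0 <= A z)%E -> (forall z, A z \is a fin_num) ->
  (forall z z', `|z'| <= `|z| -> (A z <= A z')%E) ->
  (forall z, M < `|z| -> A z = 0%E) ->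
  ((kernel_shift e be)%:E * (\int[mu]_z A z) <= \int[mu]_z ((shifted_kernel e be z)%:E * A z))%E.
Proof.
move=> M0 mA A0 Afin Amono Aout.
pose I := `[- M, M]%classic : set R.
have mI : measurable I by exact: measurable_itv.
have muI : mu I \is a fin_num.
  by rewrite lebesgue_measure_itv/=; case: ifP => //; rewrite -EFinB.
have toI (f : R -> \bar R) : (\int[mu]_z (f z * A z) = \int[mu]_(z in I) (f z * A z))%E.
  rewrite [RHS]integral_mkcond; apply: eq_integral => z _.
  rewrite patchE; case: ifPn => // /negP zI.
  rewrite Aout ?mule0// ltNge; apply/negP => zM; apply: zI.
  by rewrite inE /I/= in_itv/= -ler_norml.
have mAI : measurable_fun I A by exact: measurable_funTS.
have mH : measurable_fun setT (fun z => (shifted_kernel e be z)%:E).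
  by apply: measurable_EFin; apply: measurable_shifted_kernel; meas.
have mHI : measurable_fun I (fun z => (shifted_kernel e be z)%:E) by exact: measurable_funTS.
have gA : (\int[mu]_z A z = \int[mu]_(z in I) A z)%E.
  have := toI (fun=> 1%E).
  by under eq_integral do rewrite mul1e; under [in RHS]eq_integral do rewrite mul1e.
rewrite gA toI.
set s := width e be; have s0 : 0 < s := width_gt0 e0 be.
set a0 := A s.
have a0_ge0 : (0 <= a0)%E := A0 _.
have g0 := kernel_shift_ge0 e be; have H0 := shifted_kernel_ge0 e0 be.
have pointwise z : ((kernel_shift e be)%:E * A z + (shifted_kernel e be z)%:E * a0 <=
    (shifted_kernel e be z)%:E * A z + (kernel_shift e be)%:E * a0)%E.
  rewrite /a0 -(fineK (Afin z)) -(fineK (Afin s)) -!EFinM -!EFinD lee_fin.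
  rewrite /shifted_kernel; have [zs|sz] := leP `|z| s.
    have h := plane_kernel_ge0 s0 zs.
    have : fine (A s) <= fine (A z).
      by rewrite fine_le//; apply: Amono; rewrite (gtr0_norm s0).
    by rewrite -/s; nra.
  have h := plane_kernel_le0 s0 (ltW sz).
  have : fine (A z) <= fine (A s).
    by rewrite fine_le//; apply: Amono; rewrite (gtr0_norm s0) ltW.
  by rewrite -/s; nra.
have gfin : (a0 * \int[mu]_(z in I) (kernel_shift e be)%:E)%E \is a fin_num.
  apply: fin_numM; first exact: Afin.
  by rewrite integral_cst//; apply: fin_numM => //; exact: muI.
rewrite -(leeD2rE _ _ gfin).
apply: (@le_trans _ _ (\int[mu]_(z in I) ((kernel_shift e be)%:E * A z + (shifted_kernel e be z)%:E * a0))%E).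
  rewrite ge0_integralD//; last 4 first.
  - by move=> z _; rewrite mule_ge0// lee_fin.
  - by apply: emeasurable_funM => //; exact: measurable_cst.
  - by move=> z _; rewrite mule_ge0// lee_fin.
  - by apply: emeasurable_funM => //; exact: measurable_cst.
  rewrite ge0_integralZl ?lee_fin//.
  apply: leeD2l; rewrite ge0_integralZr//; last by move=> z _; rewrite lee_fin.
  by rewrite muleC; apply: lee_wpmul2r => //; exact: integral_shifted_kernel_segment.
rewrite [leRHS](_ : _ = (\int[mu]_(z in I) ((shifted_kernel e be z)%:E * A z + (kernel_shift e be)%:E * a0))%E).
  apply: ge0_le_integral => //.
  - by move=> z _; rewrite adde_ge0// mule_ge0// lee_fin.
  - by apply: emeasurable_funD; apply: emeasurable_funM => //; exact: measurable_cst.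
  - by apply: emeasurable_funD; apply: emeasurable_funM => //; exact: measurable_cst.
rewrite ge0_integralD//; last 3 first.
- by move=> z _; rewrite mule_ge0// lee_fin.
- by apply: emeasurable_funM.
- by move=> z _; rewrite mule_ge0// lee_fin.
congr (_ + _)%E; rewrite !integral_cst//.
- by rewrite muleCA muleA.
Qed.

Lemma poisson_mass : (\int[mu \x mu]_p (poisson_kernel e p.1 p.2)%:E = (2 * pi ^+ 2)%:E)%E.
Proof.
rewrite (@ge0_integral_prod R _ _ _ _ mu mu (fun a b => (poisson_kernel e a b)%:E)); last 2 first.
- by apply: measurable_EFin; apply: measurable_poisson_kernel; meas.
- by move=> a b; rewrite lee_fin poisson_kernel_ge0.
have c0 (a : R) : 0 <= e / (e ^+ 2 + a ^+ 2) by rewrite divr_ge0 ?ltW// sqr_add_gt0.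
have E1 a : (\int[mu]_b (poisson_kernel e a b)%:E = (2 * pi)%:E * (e / (e ^+ 2 + a ^+ 2))%:E)%E.
  transitivity (\int[mu]_b ((2 * (e / (e ^+ 2 + a ^+ 2)))%:E * (e / (e ^+ 2 + b ^+ 2))%:E))%E.
    by apply: eq_integral => b _; rewrite -EFinM /poisson_kernel mulrA.
  rewrite ge0_integralZl//; [|by meas|by move=> b _; rewrite lee_fin|by rewrite lee_fin mulr_ge0].
  by rewrite integral_cauchy// -!EFinM; congr (_%:E); ring.
under eq_integral do rewrite E1.
rewrite ge0_integralZl//; [|by meas|by move=> b _; rewrite lee_fin|by rewrite lee_fin mulr_ge0// pi_ge0].
by rewrite integral_cauchy// -EFinM; congr (_%:E); ring.
Qed.

Lemma poisson_mass_square (t : R) : 0 < t ->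
  (\int[mu \x mu]_(p in `[(- t)%R, t] `*` `[(- t)%R, t]) (poisson_kernel e p.1 p.2)%:E =
    (2 * (2 * atan (t / e)) ^+ 2)%:E)%E.
Proof.
move=> t0; set I := `[(- t)%R, t]%classic.
have mI : measurable (I : set R) by exact: measurable_itv.
have mIe : measurable_fun setT (\1_I : R -> R) by exact: measurable_indic.
have c0 (a : R) : 0 <= e / (e ^+ 2 + a ^+ 2) by rewrite divr_ge0 ?ltW// sqr_add_gt0.
pose c a : R := e / (e ^+ 2 + a ^+ 2) * \1_I a.
have mc : measurable_fun setT c by rewrite /c; meas.
have c0' a : 0 <= c a by rewrite mulr_ge0.
have cE : (\int[mu]_a (c a)%:E = (2 * atan (t / e))%:E)%E.
  rewrite -integral_cauchy_segment// [RHS]integral_mkcond; apply: eq_integral => a _.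
  by rewrite patchE /c indicE; case: ifPn => _; rewrite ?mulr1 ?mulr0.
transitivity (\int[mu \x mu]_p (2 * (c p.1 * c p.2))%:E)%E.
  rewrite integral_mkcond; apply: eq_integral => -[a b] _.
  rewrite patchE /c !indicE/= in_setX /poisson_kernel.
  by case: (a \in I); case: (b \in I); rewrite /= ?mulr1 ?mulr0 ?mul0r ?mulr0.
rewrite (@ge0_integral_prod R _ _ _ _ mu mu (fun a b => (2 * (c a * c b))%:E)); last 2 first.
- have m1 : measurable_fun setT (fun p : R * R => c p.1) by exact: measurableT_comp.
  have m2 : measurable_fun setT (fun p : R * R => c p.2) by exact: measurableT_comp.
  by meas.
- by move=> a b; rewrite lee_fin mulr_ge0// mulr_ge0.
have a0 : 0 <= 2 * atan (t / e).
  by rewrite -lee_fin -cE integral_ge0// => a _; rewrite lee_fin.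
have E1 a : (\int[mu]_b (2 * (c a * c b))%:E = (2 * (2 * atan (t / e)))%:E * (c a)%:E)%E.
  transitivity (\int[mu]_b ((2 * c a)%:E * (c b)%:E))%E.
    by apply: eq_integral => b _; rewrite -EFinM mulrA.
  rewrite ge0_integralZl//; [|by meas|by move=> b _; rewrite lee_fin|by rewrite lee_fin mulr_ge0].
  by rewrite cE -!EFinM; congr (_%:E); ring.
under eq_integral do rewrite E1.
rewrite ge0_integralZl//; [|by meas|by move=> b _; rewrite lee_fin|by rewrite lee_fin mulr_ge0].
by rewrite cE -EFinM; congr (_%:E); ring.
Qed.

End WeightedSection.

(** * The weight of a plane and its integral over a pencil of planes *)

Section Transform.
Context {R : realType}.
Local Notation mu := (@lebesgue_measure R).
Local Notation lam2 := (mu \x mu)%E.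
Local Notation lam2s := (product_measure mu mu).
Local Notation lam3s := (product_measure lam2s mu).
Local Notation lam3 := ((mu \x mu) \x mu)%E.

Lemma spatial_measureE (A : set (R * R * R)) : measurable A ->
  (lam3 A = \int[lam2]_p \int[mu]_z (\1_A (p, z))%:E)%E.
Proof.
move=> mA; rewrite -[A in LHS]setIT -integral_indic//.
rewrite -(@ge0_integral_prod R _ _ _ _ lam2s mu (fun p z => (\1_A (p, z))%:E))//; last by meas.
by apply: eq_integral => -[p z] _.
Qed.

Variables (K : set (R * R * R)) (M e : R).
Hypothesis M0 : 0 < M.
Hypothesis e0 : 0 < e.
Hypothesis mK : measurable K.
Hypothesis K_convex : convex3 K.
Hypothesis K_sym : symmetric3 K.
Hypothesis K_bnd : bounded3 M K.

Let V : \bar R := lam3 K.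

Let box_fin (N : R) : mu `[- N, N]%classic \is a fin_num.
Proof. by rewrite lebesgue_measure_itv/=; case: ifP => //; rewrite -EFinB. Qed.

Let square (N : R) : set (R * R) := `[- N, N] `*` `[- N, N].

Let lam2_square_fin N : lam2 (square N) \is a fin_num.
Proof.
rewrite /square product_measure1E//=; try exact: measurable_itv.
by apply: fin_numM; exact: box_fin.
Qed.

Let m_square N : measurable (square N).
Proof. by apply: measurableX; exact: measurable_itv. Qed.

Lemma volume_fin_num : V \is a fin_num.
Proof.
rewrite ge0_fin_numE; last exact: (measure_ge0 lam3s).
apply: (@le_lt_trans _ _ (lam3 (square M `*` `[- M, M]%classic))).
  apply: le_measure; rewrite ?inE//.
    exact: measurableX (m_square M) (measurable_itv _).
  by move=> [[x y] z] /K_bnd[]; rewrite !ler_norml /square/= !in_itv/= => -> -> ->.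
rewrite [ltLHS](@product_measure1E _ _ _ _ _ lam2s mu); [|exact: m_square|exact: measurable_itv].
by rewrite -ge0_fin_numE ?mule_ge0//; apply: fin_numM; [exact: lam2_square_fin|exact: box_fin].
Qed.

Section Shear.
Variables (al be : R).

Let C : set (R * R * R) := [set p | K (p.1, p.2 + (al * p.1.1 + be * p.1.2))].
Let N := M * (1 + `|al| + `|be|).

Let mC : measurable C.
Proof.
by apply: (measurable_preimage
  (f := fun p : R * R * R => (p.1, p.2 + (al * p.1.1 + be * p.1.2)))) => //; meas.
Qed.

Let C_convex : convex3 C.
Proof.
move=> t x y z x' y' z'; rewrite /C/= => t01 c c'; have := K_convex t01 c c'.
by congr (K (_, _)); ring.
Qed.

Let C_sym : symmetric3 C.
Proof. by move=> x y z; rewrite /C/= => /K_sym; congr (K (_, _)); ring. Qed.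

Let C_bnd : bounded3 N C.
Proof.
move=> x y z; rewrite /C/= => /K_bnd[xM yM zM].
have a0 := normr_ge0 al; have b0 := normr_ge0 be.
have MN : M <= N by rewrite /N -[leLHS]mulr1 ler_pM2l//; lra.
split; [exact: le_trans MN|exact: le_trans MN|].
have -> : z = (z + (al * x + be * y)) - (al * x + be * y) by ring.
apply: (le_trans (ler_normB _ _)).
have h1 : `|al * x + be * y| <= `|al| * M + `|be| * M.
  apply: (le_trans (ler_normD _ _)); rewrite !normrM.
  by apply: lerD; apply: ler_wpM2l.
by rewrite /N; lra.
Qed.

(** The section by the plane of height [z] over [z = al x + be y], measured by the area of its
    projection along the third axis. *)
Definition section_area z : \bar R := lam2 [set p | K (p, z + (al * p.1 + be * p.2))].

Let sectionE z : section_area z = (\int[lam2]_p (\1_C (p, z))%:E)%E.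
Proof.
rewrite /section_area -[X in lam2 X]setIT -integral_indic//.
by apply: (measurable_preimage (f := fun p => (p, z + (al * p.1 + be * p.2)))) => //; meas.
Qed.

Let sectionE2 z : section_area z = (\int[mu]_x \int[mu]_y (\1_C (x, y, z))%:E)%E.
Proof.
rewrite sectionE.
rewrite -(@ge0_integral_prod R _ _ _ _ mu mu (fun x y => (\1_C (x, y, z))%:E))//; last by meas.
by apply: eq_integral => -[x y] _.
Qed.

Let section_ge0 z : (0 <= section_area z)%E.
Proof. exact: measure_ge0. Qed.

Let section_fin z : section_area z \is a fin_num.
Proof.
rewrite ge0_fin_numE; last exact: section_ge0.
apply: (@le_lt_trans _ _ (lam2 (square N))).
  apply: le_measure; rewrite ?inE; [|exact: m_square|].
    by apply: (measurable_preimage (f := fun p => (p, z + (al * p.1 + be * p.2)))) => //; meas.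
  move=> [x y] Cxy; have [] := @C_bnd x y z Cxy.
  by rewrite !ler_norml /square/= !in_itv/= => -> ->.
rewrite -ge0_fin_numE; [exact: lam2_square_fin|exact: (measure_ge0 lam2s)].
Qed.

Let m_section : measurable_fun setT section_area.
Proof.
have h := @measurable_ge0_integral R _ _ _ _ lam2s (fun z p => (\1_C (p, z))%:E).
rewrite (_ : section_area = fun z => \int[lam2]_p (\1_C (p, z))%:E)%E.
  by apply: h => //; meas.
by apply/funext => z; rewrite sectionE.
Qed.

(** Integration over [K] of a function of the height above the plane [z = al x + be y] slices [K]
    by the parallels to this plane. *)
Lemma integral_shear (phi : R -> R) : measurable_fun setT phi -> (forall z, 0 <= phi z) ->
  (\int[lam2]_p \int[mu]_z (\1_K (p, z) * phi (z - (al * p.1 + be * p.2)))%:E =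
   \int[mu]_z ((phi z)%:E * section_area z))%E.
Proof.
move=> mphi phi0.
transitivity (\int[lam2]_p \int[mu]_z ((phi z)%:E * (\1_C (p, z))%:E))%E.
  apply: eq_integral => p _.
  rewrite -(@ge0_integral_translate R (al * p.1 + be * p.2)
    (fun z : R => (\1_K (p, z) * phi (z - (al * p.1 + be * p.2)))%:E)).
  - apply: eq_integral => z _; rewrite addrK -EFinM mulrC; congr (_ * _)%:E.
  - have h : measurable_fun setT (fun z : R => phi (z - (al * p.1 + be * p.2))).
      by apply: (measurableT_comp mphi); meas.
    meas.
  - by move=> z; rewrite lee_fin mulr_ge0.
rewrite (@exchange_ge0_integral R _ _ _ _ lam2s mu (fun p z => (phi z)%:E * (\1_C (p, z))%:E)%E).
- apply: eq_integral => z _; rewrite sectionE ge0_integralZl//.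
  + by meas.
  + by rewrite lee_fin.
- have h : measurable_fun setT (fun p : R * R * R => phi p.2).
    by apply: (measurableT_comp mphi); meas.
  meas.
- by move=> p z; rewrite -EFinM lee_fin mulr_ge0.
Qed.

Lemma shifted_kernel_transform_ge :
  ((kernel_shift e be)%:E * V <=
   \int[lam2]_p \int[mu]_z (\1_K (p, z) * shifted_kernel e be (z - (al * p.1 + be * p.2)))%:E)%E.
Proof.
have H0 := shifted_kernel_ge0 e0 be.
rewrite integral_shear//; last by apply: measurable_shifted_kernel; meas.
have -> : V = (\int[mu]_z section_area z)%E.
  transitivity (\int[mu]_z ((1%R)%:E * section_area z))%E; last first.
    by apply: eq_integral => z _; rewrite mul1e.
  rewrite -(integral_shear (phi := fun=> 1))//.
  rewrite /V spatial_measureE//; apply: eq_integral => p _; apply: eq_integral => z _.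
  by rewrite mulr1.
have N0 : 0 < N.
  by rewrite /N mulr_gt0//; have := normr_ge0 al; have := normr_ge0 be; lra.
have h := @integral_shifted_kernel_weighted R e e0 be N section_area N0 m_section section_ge0 section_fin.
apply: h.
- by move=> z z' zz'; rewrite !sectionE2; apply: (parallel_section_le (M := N)).
- move=> z Nz; rewrite sectionE integral0_eq// => -[x y] _.
  by rewrite indicE memNset// => /C_bnd[_ _]; rewrite leNgt Nz.
Qed.
End Shear.

(** The weight with the shifted kernel, hence with a nonnegative integrand. *)
Let W (q : R * R) : \bar R := (\int[lam2]_p \int[mu]_z
  (\1_K (p, z) * shifted_kernel e q.1 (z - (q.2 * p.1 + q.1 * p.2)))%:E)%E.

Let m_W : measurable_fun setT W.
Proof.
have h := @measurable_ge0_integral R _ _ _ _ lam2s (fun (q : R * R) p => \int[mu]_z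
  (\1_K (p, z) * shifted_kernel e q.1 (z - (q.2 * p.1 + q.1 * p.2)))%:E)%E.
apply: h; last by move=> q p; apply: integral_ge0 => z _; rewrite lee_fin mulr_ge0// shifted_kernel_ge0.
have h := @measurable_ge0_integral R _ _ _ _ mu (fun (qp : R * R * (R * R)) z =>
  (\1_K (qp.2, z) * shifted_kernel e qp.1.1 (z - (qp.1.2 * qp.2.1 + qp.1.1 * qp.2.2)))%:E)%E.
apply: h; last by move=> q p; rewrite lee_fin mulr_ge0// shifted_kernel_ge0.
have mH : measurable_fun setT (fun p : R * R * (R * R) * R =>
   shifted_kernel e p.1.1.1 (p.2 - (p.1.1.2 * p.1.2.1 + p.1.1.1 * p.1.2.2))).
  by apply: measurable_shifted_kernel; meas.
by meas.
Qed.

(** The weight [w] of the plane [z = q.2 x + q.1 y]; the integral over [K] of the shift is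
    subtracted. *)
Definition weight (q : R * R) : \bar R := (W q - (kernel_shift e q.1)%:E * V)%E.

Lemma weight_ge0 q : (0 <= weight q)%E.
Proof.
have gV : ((kernel_shift e q.1)%:E * V)%E \is a fin_num.
  by apply: fin_numM => //; exact: volume_fin_num.
by rewrite /weight sube_ge0 ?gV ?orbT//; exact: shifted_kernel_transform_ge.
Qed.

Lemma measurable_weight : measurable_fun setT weight.
Proof.
apply: emeasurable_funB; first exact: m_W.
apply: emeasurable_funM; last exact: measurable_cst.
by apply: measurable_EFin; apply: measurable_kernel_shift; meas.
Qed.

Let poisson_line (m2 m3 : R) (p : R * R) (z : R) : R :=
  \1_K (p, z) * poisson_kernel e (p.2 - m2 * p.1) (z - m3 * p.1).

Let poisson_line_ge0 m2 m3 p z : 0 <= poisson_line m2 m3 p z.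
Proof. by rewrite mulr_ge0// poisson_kernel_ge0. Qed.

Let m_poisson_line m2 m3 :
  measurable_fun setT (fun p : R * R * R => poisson_line m2 m3 p.1 p.2).
Proof.
have h : measurable_fun setT
    (fun p : R * R * R => poisson_kernel e (p.1.2 - m2 * p.1.1) (p.2 - m3 * p.1.1)).
  by apply: measurable_poisson_kernel; meas.
by rewrite /poisson_line; meas.
Qed.

(** The planes [(be, m3 - be * m2)] are those that contain the line spanned by [(1, m2, m3)].  The
    height of [(x, y, z)] above such a plane is [(z - m3 x) - be (y - m2 x)], so that
    [integral_shifted_kernel] applies after the exchange of the integrals. *)
Let integral_W_line (m2 m3 : R) :
  (\int[mu]_be W (be, m3 - be * m2)%R =
   \int[lam2]_p \int[mu]_z (poisson_line m2 m3 p z)%:E + (2 / e ^+ 2)%:E * V)%E.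
Proof.
pose F (be : R) (p : R * R) (z : R) : R :=
  \1_K (p, z) * shifted_kernel e be ((z - m3 * p.1) - be * (p.2 - m2 * p.1)).
have F0 be p z : 0 <= F be p z by rewrite mulr_ge0// shifted_kernel_ge0.
have mF : measurable_fun setT (fun t : R * (R * R) * R => F t.1.1 t.1.2 t.2).
  have h : measurable_fun setT (fun t : R * (R * R) * R =>
      shifted_kernel e t.1.1 ((t.2 - m3 * t.1.2.1) - t.1.1 * (t.1.2.2 - m2 * t.1.2.1))).
    by apply: measurable_shifted_kernel; meas.
  by rewrite /F; meas.
transitivity (\int[mu]_be \int[lam2]_p \int[mu]_z (F be p z)%:E)%E.
  apply: eq_integral => be _; apply: eq_integral => p _; apply: eq_integral => z _.
  by rewrite /F /=; congr (_ * shifted_kernel _ _ _)%:E; ring.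
rewrite (@exchange_ge0_integral R _ _ _ _ mu lam2s (fun be p => \int[mu]_z (F be p z)%:E)%E); last 2 first.
- have h := @measurable_ge0_integral R _ _ _ _ mu
    (fun (t : R * (R * R)) z => (F t.1 t.2 z)%:E).
  apply: h; first exact: (measurable_EFin mF).
  by move=> t z; rewrite lee_fin.
- by move=> be p; apply: integral_ge0 => z _; rewrite lee_fin.
transitivity (\int[lam2]_p \int[mu]_z
    ((poisson_line m2 m3 p z)%:E + (2 / e ^+ 2)%:E * (\1_K (p, z))%:E))%E.
  apply: eq_integral => p _.
  rewrite (@exchange_ge0_integral R _ _ _ _ mu mu (fun be z => (F be p z)%:E)); last 2 first.
  - apply: measurable_EFin.
    by apply: (measurableT_comp (g := fun t : R * R => (t.1, p, t.2)) mF); meas.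
  - by move=> be z; rewrite lee_fin.
  apply: eq_integral => z _.
  transitivity (\int[mu]_be ((\1_K (p, z))%:E *
      (shifted_kernel e be ((z - m3 * p.1) - be * (p.2 - m2 * p.1)))%:E))%E.
    by apply: eq_integral => be _; rewrite -EFinM.
  rewrite ge0_integralZl//.
  - by rewrite integral_shifted_kernel// -!EFinM -EFinD; congr (_%:E); rewrite /poisson_line; ring.
  - by apply: measurable_EFin; apply: measurable_shifted_kernel; meas.
  - by move=> be _; rewrite lee_fin shifted_kernel_ge0.
have e20 : 0 <= 2 / e ^+ 2 by rewrite divr_ge0// sqr_ge0.
have mPL : measurable_fun setT (fun p : R * R * R => (poisson_line m2 m3 p.1 p.2)%:E).
  exact: (measurable_EFin (@m_poisson_line m2 m3)).
have e20E : (0 <= (2 / e ^+ 2)%:E)%E by rewrite lee_fin.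
rewrite /V spatial_measureE// -ge0_integralZl//; last 2 first.
- have h := @measurable_ge0_integral R _ _ _ _ mu (fun p z => (\1_K (p, z))%:E)%E.
  by apply: h => //; meas.
- by move=> p _; exact: integral_ge0.
rewrite -ge0_integralD//; first last.
- apply: emeasurable_funM; first exact: measurable_cst.
  have h := @measurable_ge0_integral R _ _ _ _ mu (fun p z => (\1_K (p, z))%:E)%E.
  by apply: h => //; meas.
- by move=> p _; rewrite mule_ge0//; exact: integral_ge0.
- have h := @measurable_ge0_integral R _ _ _ _ mu (fun p z => (poisson_line m2 m3 p z)%:E)%E.
  by apply: h => // p z; rewrite lee_fin.
- by move=> p _; apply: integral_ge0 => z _; rewrite lee_fin.
apply: eq_integral => p _; rewrite ge0_integralD//.
- by rewrite ge0_integralZl//; meas.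
- by move=> z _; rewrite lee_fin.
- by apply: (measurableT_comp (g := fun z : R => (p, z)) mPL); meas.
- by move=> z _; rewrite mule_ge0.
- by meas.
Qed.

(** The length, measured along the first axis, of the chord of [K] that has the direction
    [(1, m2, m3)] and passes through [(0, q.1, q.2)]. *)
Definition chord_length (m2 m3 : R) (q : R * R) : \bar R :=
  mu [set x | K (x, q.1 + m2 * x, q.2 + m3 * x)].

(** Slices [K] by the lines of direction [(1, m2, m3)]. *)
Let poisson_lineE (m2 m3 : R) :
  (\int[lam2]_p \int[mu]_z (poisson_line m2 m3 p z)%:E =
   \int[lam2]_q ((poisson_kernel e q.1 q.2)%:E * chord_length m2 m3 q))%E.
Proof.
pose F (x a b : R) : R := \1_K (x, a + m2 * x, b + m3 * x) * poisson_kernel e a b.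
have F0 x a b : 0 <= F x a b by rewrite mulr_ge0// poisson_kernel_ge0.
have mF : measurable_fun setT (fun t : R * (R * R) => F t.1 t.2.1 t.2.2).
  have h : measurable_fun setT (fun t : R * (R * R) => poisson_kernel e t.2.1 t.2.2).
    by apply: measurable_poisson_kernel; meas.
  by rewrite /F; meas.
have mPL : measurable_fun setT (fun p : R * R * R => (poisson_line m2 m3 p.1 p.2)%:E).
  exact: (measurable_EFin (@m_poisson_line m2 m3)).
transitivity (\int[mu]_x \int[mu]_y \int[mu]_z (poisson_line m2 m3 (x, y) z)%:E)%E.
  rewrite -(@ge0_integral_prod R _ _ _ _ mu mu
    (fun x y => \int[mu]_z (poisson_line m2 m3 (x, y) z)%:E)%E).
  - by apply: eq_integral => -[x y] _.
  - have h := @measurable_ge0_integral R _ _ _ _ mu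
      (fun (p : R * R) z => (poisson_line m2 m3 (p.1, p.2) z)%:E)%E.
    apply: h; last by move=> p z; rewrite lee_fin.
    by apply: (measurableT_comp (g := fun t : R * R * R => (t.1.1, t.1.2, t.2)) mPL); meas.
  - by move=> x y; apply: integral_ge0 => z _; rewrite lee_fin.
transitivity (\int[mu]_x \int[lam2]_q (F x q.1 q.2)%:E)%E; last first.
  rewrite (@exchange_ge0_integral R _ _ _ _ mu lam2s (fun x q => (F x q.1 q.2)%:E)); last 2 first.
  - exact: (measurable_EFin mF).
  - by move=> x q; rewrite lee_fin.
  apply: eq_integral => q _.
  have mS : measurable [set x | K (x, q.1 + m2 * x, q.2 + m3 * x)].
    by apply: (measurable_preimage (f := fun x => (x, q.1 + m2 * x, q.2 + m3 * x))) => //; meas.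
  rewrite /chord_length -[X in mu X]setIT -integral_indic//.
  rewrite -ge0_integralZl//.
  - by apply: eq_integral => x _; rewrite -EFinM mulrC.
  - by apply: measurable_EFin; exact: measurable_indic.
  - by rewrite lee_fin poisson_kernel_ge0.
apply: eq_integral => x _.
rewrite (@ge0_integral_prod R _ _ _ _ mu mu (fun a b => (F x a b)%:E)); last 2 first.
- apply: measurable_EFin.
  by apply: (measurableT_comp (g := fun t : R * R => (x, t)) mF); meas.
- by move=> a b; rewrite lee_fin.
rewrite -(@ge0_integral_translate R (m2 * x)
  (fun y => \int[mu]_z (poisson_line m2 m3 (x, y) z)%:E)%E); last 2 first.
- have h := @measurable_ge0_integral R _ _ _ _ mu
    (fun y z => (poisson_line m2 m3 (x, y) z)%:E)%E.
  apply: h; last by move=> p z; rewrite lee_fin.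
  by apply: (measurableT_comp (g := fun t : R * R => (x, t.1, t.2)) mPL); meas.
- by move=> y; apply: integral_ge0 => z _; rewrite lee_fin.
apply: eq_integral => a _.
rewrite -(@ge0_integral_translate R (m3 * x)
  (fun z => (poisson_line m2 m3 (x, a + m2 * x) z)%:E)); last 2 first.
- by apply: (measurableT_comp (g := fun t : R => (x, a + m2 * x, t)) mPL); meas.
- by move=> y; rewrite lee_fin.
by apply: eq_integral => b _; rewrite /poisson_line /F /= !addrK.
Qed.

Lemma integral_weight_line (m2 m3 : R) :
  (\int[mu]_be weight (be, m3 - be * m2)%R =
   \int[lam2]_q ((poisson_kernel e q.1 q.2)%:E * chord_length m2 m3 q))%E.
Proof.
rewrite -poisson_lineE.
have VG : ((2 / e ^+ 2)%:E * V)%E \is a fin_num.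
  by apply: fin_numM => //; exact: volume_fin_num.
have V0 : (0 <= V)%E := measure_ge0 lam3s _.
have mw : measurable_fun setT (fun be : R => weight (be, m3 - be * m2)).
  by apply: (measurableT_comp (g := fun be : R => (be, m3 - be * m2)) measurable_weight); meas.
have mg : measurable_fun setT (fun be : R => (kernel_shift e be)%:E).
  by apply: measurable_EFin; apply: measurable_kernel_shift; meas.
rewrite -[LHS](addeK _ VG) -[RHS](addeK _ VG) -integral_W_line; congr (_ - _)%E.
rewrite -integral_kernel_shift// -ge0_integralZr//; last by move=> be _; rewrite lee_fin kernel_shift_ge0.
rewrite -ge0_integralD//; last 3 first.
- by move=> be _; exact: weight_ge0.
- by move=> be _; rewrite mule_ge0// lee_fin kernel_shift_ge0.
- by apply: emeasurable_funM => //; exact: measurable_cst.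
apply: eq_integral => be _; rewrite /weight subeK//.
by apply: fin_numM => //; exact: volume_fin_num.
Qed.

End Transform.

Section Disintegration.
Context {R : realType}.
Local Notation mu := (@lebesgue_measure R).
Local Notation lam2 := (mu \x mu)%E.
Local Notation lam2s := (product_measure mu mu).
Local Notation lam3 := ((mu \x mu) \x mu)%E.
Local Notation lam3s := (product_measure lam2s mu).

Variable w : R * R -> \bar R.
Hypothesis mw : measurable_fun setT w.
Hypothesis w0 : forall q, (0 <= w q)%E.

(** The function [f], at the point [(p.1, p.2, z)].  It vanishes for [p.1 = 0], as the inverse of
    [0] is [0]. *)
Definition pencil_integral (p : R * R) (z : R) : \bar R :=
  ((`|p.1|^-1)%:E * \int[mu]_be w (be, z / p.1 - be * (p.2 / p.1))%R)%E.

Lemma pencil_integral_ge0 p z : (0 <= pencil_integral p z)%E.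
Proof.
by rewrite /pencil_integral mule_ge0 ?lee_fin ?invr_ge0//; exact: integral_ge0.
Qed.

Lemma measurable_pencil_integral :
  measurable_fun setT (fun p : R * R * R => pencil_integral p.1 p.2).
Proof.
apply: emeasurable_funM; first by meas.
have h := @measurable_ge0_integral R _ _ _ _ mu
  (fun (t : R * R * R) be => w (be, t.2 / t.1.1 - be * (t.1.2 / t.1.1))).
apply: h => //.
by apply: (measurableT_comp mw
  (g := fun s : R * R * R * R => (s.2, s.1.2 / s.1.1.1 - s.2 * (s.1.1.2 / s.1.1.1)))); meas.
Qed.

(** For fixed [p] and [be], the substitution [z = al p.1 + be p.2] turns [dz / |p.1|] into [d al]; then
    both sides integrate [w] over the pairs of a point of [L] and a plane through it. *)
Lemma integral_pencil (L : set (R * R * R)) : measurable L ->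
  (forall p, L p -> p.1.1 != 0) ->
  (\int[lam2]_p \int[mu]_z ((\1_L (p, z))%:E * pencil_integral p z) =
   \int[lam2]_q (w q * lam2 [set p | L (p, q.2 * p.1 + q.1 * p.2)%R]))%E.
Proof.
move=> mL L0.
pose Phi (p q : R * R) : \bar R :=
  ((\1_L (p, q.2 * p.1 + q.1 * p.2)%R)%:E * w q)%E.
have Phi0 p q : (0 <= Phi p q)%E by rewrite mule_ge0// lee_fin.
have mPhi : measurable_fun setT (fun t : R * R * (R * R) => Phi t.1 t.2).
  rewrite /Phi; have h : measurable_fun setT (fun t : R * R * (R * R) => w t.2).
    by apply: (measurableT_comp mw); meas.
  by meas.
transitivity (\int[lam2]_p \int[lam2]_q Phi p q)%E; last first.
  rewrite (@exchange_ge0_integral R _ _ _ _ lam2s lam2s Phi)//.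
  apply: eq_integral => q _.
  have mS : measurable [set p | L (p, q.2 * p.1 + q.1 * p.2)].
    by apply: (measurable_preimage (f := fun p => (p, q.2 * p.1 + q.1 * p.2))) => //; meas.
  rewrite -[X in lam2 X]setIT -integral_indic//.
  rewrite -ge0_integralZl//.
  - by apply: eq_integral => p _; rewrite muleC.
  - by apply: measurable_EFin; exact: measurable_indic.
apply: eq_integral => p _.
have [p0|p0] := eqVneq p.1 0.
  rewrite integral0_eq; last first.
    by move=> z _; rewrite indicE memNset ?mul0e// => /L0; rewrite p0 eqxx.
  rewrite integral0_eq// => q _.
  by rewrite /Phi indicE memNset ?mul0e// => /L0; rewrite p0 eqxx.
have mPhip : measurable_fun setT (Phi p).
  by apply: (measurableT_comp (g := fun q : R * R => (p, q)) mPhi); meas.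
pose G (be z : R) : \bar R := Phi p (be, p.1^-1 * z + (- (be * (p.2 / p.1)))).
have mG : measurable_fun setT (fun t : R * R => G t.1 t.2).
  by apply: (measurableT_comp (g := fun t : R * R =>
    (t.1, p.1^-1 * t.2 + (- (t.1 * (p.2 / p.1))))) mPhip); meas.
transitivity (\int[mu]_be \int[mu]_z ((`|p.1|^-1)%:E * G be z))%E.
  rewrite (@exchange_ge0_integral R _ _ _ _ mu mu (fun be z => (`|p.1|^-1)%:E * G be z)%E); last 2 first.
  - by apply: emeasurable_funM => //; exact: measurable_cst.
  - by move=> be z; rewrite mule_ge0 ?lee_fin ?invr_ge0//; exact: Phi0.
  apply: eq_integral => z _.
  rewrite /pencil_integral muleCA -ge0_integralZl ?lee_fin//; last first.
  - by apply: (measurableT_comp mw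
      (g := fun be : R => (be, z / p.1 - be * (p.2 / p.1)))); meas.
  rewrite -ge0_integralZl ?lee_fin ?invr_ge0//; last 2 first.
  - apply: emeasurable_funM; first exact: measurable_cst.
    by apply: (measurableT_comp mw
      (g := fun be : R => (be, z / p.1 - be * (p.2 / p.1)))); meas.
  - by move=> be _; rewrite mule_ge0 ?lee_fin//.
  apply: eq_integral => be _; congr (_ * _)%E.
  rewrite /G /Phi /=; congr ((\1_L (_, _))%:E * w (_, _))%E; last by rewrite mulrC.
  by field.
rewrite -[RHS](_ : \int[mu]_be \int[mu]_al Phi p (be, al) = _)%E; last first.
  have h : measurable_fun setT (fun t : R * R => Phi p (t.1, t.2)).
    by rewrite (_ : (fun _ => _) = Phi p)//; apply/funext => -[].
  rewrite -(@ge0_integral_prod R _ _ _ _ mu mu (fun be al => Phi p (be, al)))//.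
  by apply: eq_integral => -[be al] _.
apply: eq_integral => be _.
have mP : measurable_fun setT (fun al : R => Phi p (be, al)).
  by apply: (measurableT_comp (g := fun t : R => (be, t)) mPhip); meas.
rewrite ge0_integralZl ?lee_fin ?invr_ge0//; last 2 first.
- by apply: (measurableT_comp (g := fun t : R => (be, t)) mG); meas.
- by move=> z _; exact: Phi0.
have p0' : p.1^-1 != 0 by rewrite invr_eq0.
by rewrite (@ge0_integral_affine R p.1^-1 (- (be * (p.2 / p.1))) _ p0' mP)// normfV.
Qed.
End Disintegration.

Section Bounds.
Context {R : realType}.
Local Notation mu := (@lebesgue_measure R).
Local Notation lam2 := (mu \x mu)%E.
Local Notation lam2s := (product_measure mu mu).
Local Notation lam3 := ((mu \x mu) \x mu)%E.
Local Notation lam3s := (product_measure lam2s mu).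

Variables (K : set (R * R * R)) (M r e : R).
Hypothesis M0 : 0 < M.
Hypothesis r0 : 0 < r.
Hypothesis e0 : 0 < e.
Hypothesis mK : measurable K.
Hypothesis K_convex : convex3 K.
Hypothesis K_sym : symmetric3 K.
Hypothesis K_bnd : bounded3 M K.
Hypothesis K_cube : forall x y z, `|x| <= r -> `|y| <= r -> `|z| <= r -> K (x, y, z).

Let K_shrink s x y z : `|s| <= 1 -> K (x, y, z) -> K (s * x, s * y, s * z).
Proof.
rewrite ler_norml => /andP[s0 s1] Kxyz.
have t01 : 0 <= (1 + s) / 2 <= 1 by apply/andP; split; lra.
have := K_convex t01 Kxyz (K_sym Kxyz).
by congr (K (_, _, _)); field.
Qed.

Let m_line (m2 m3 a b : R) : measurable [set x | K (x, a + m2 * x, b + m3 * x)].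
Proof.
by apply: (measurable_preimage (f := fun x => (x, a + m2 * x, b + m3 * x))) => //; meas.
Qed.

Let line_interval (m2 m3 a b : R) : is_interval [set x | K (x, a + m2 * x, b + m3 * x)].
Proof.
move=> x y Kx Ky z /between_convex_comb[t t01 ->].
have := K_convex t01 Kx Ky.
by rewrite /=; congr (K (_, _, _)); ring.
Qed.

(** The chord through [(0, q.1, q.2)] and its mirror image have the same length, and the central chord
    contains their mean. *)
Lemma chord_length_le_central m2 m3 q :
  (chord_length K m2 m3 q <= chord_length K m2 m3 (0%R, 0%R))%E.
Proof.
rewrite /chord_length; set A := [set x | _].
have [->|/set0P A0] := eqVneq A set0; first by rewrite measure0.
have mA : measurable A by exact: m_line.
have h01 : 0 <= (2^-1 : R) <= 1 by apply/andP; split; lra.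
have := @brunn_minkowski_interval R A [set x | A (- x)]
  [set x | K (x, 0 + m2 * x, 0 + m3 * x)] 2^-1 M h01 mA.
have h1 : (0 <= (2^-1 : R)%:E)%E by rewrite lee_fin; lra.
have h2 : (0 <= (1 - 2^-1 : R)%:E)%E by rewrite lee_fin; lra.
have h12 : 2^-1 + (1 - 2^-1) = 1 :> R by ring.
rewrite lebesgue_measure_oppr// -(ge0_muleDl _ h1 h2) -EFinD h12.
rewrite mul1e; apply.
- by apply: (@measurable_preimage _ R _ R (fun x : R => - x) A) => //; meas.
- exact: A0.
- by case: A0 => x Ax; exists (- x); rewrite /= opprK.
- by move=> x /K_bnd[].
- by move=> x /K_bnd[]; rewrite normrN.
- exact: line_interval.
- move=> a b Aa /K_sym; rewrite opprK => Ab.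
  have := K_convex h01 Aa Ab; rewrite /=.
  by congr (K (_, _, _)); field.
Qed.

Lemma chord_length_outside (y1 y2 y3 : R) : y1 != 0 -> ~ K (y1, y2, y3) ->
  (chord_length K (y2 / y1) (y3 / y1) (0%R, 0%R) <= (2 * `|y1|)%:E)%E.
Proof.
move=> y10 Ky.
have y1n : 0 < `|y1| by rewrite normr_gt0.
have -> : (2 * `|y1|)%:E = mu `[- `|y1|, `|y1|]%classic.
  rewrite lebesgue_measure_itv/= lte_fin; case: ifPn => [_|/negP[]]; last lra.
  by rewrite -EFinB; congr (_%:E); ring.
apply: le_measure; rewrite ?inE; [exact: m_line|exact: measurable_itv|].
move=> x /=; rewrite !add0r => Kx; rewrite in_itv/= -ler_norml leNgt; apply/negP => yx.
apply: Ky; have x0 : x != 0 by apply/eqP => x0; move: yx; rewrite x0 normr0 ltNge normr_ge0.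
have : `|y1 / x| <= 1 by rewrite normrM normfV ler_pdivrMr ?normr_gt0// mul1r ltW.
move=> /K_shrink => /(_ _ _ _ Kx).
by congr (K (_, _, _)); field; rewrite ?x0 ?y10.
Qed.

(** The central chord through a point of [K] has length at least [2 |y1|].  Shrinking it by the factor
    [1 - t] leaves room to translate it, by convexity, by [t] times any point of the cube of
    half-side [r] contained in [K]. *)
Lemma chord_length_inside (y1 y2 y3 a b t : R) : y1 != 0 -> K (y1, y2, y3) ->
  0 < t < 1 -> `|a| <= t * r -> `|b| <= t * r ->
  ((2 * (1 - t) * `|y1|)%:E <= chord_length K (y2 / y1) (y3 / y1) (a, b))%E.
Proof.
move=> y10 Ky /andP[t0 t1] atr btr.
have y1n : 0 < `|y1| by rewrite normr_gt0.
have t1' : 0 < 1 - t by lra.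
pose c := (1 - t) * `|y1|.
have c0 : 0 < c by rewrite mulr_gt0.
have -> : (2 * (1 - t) * `|y1|)%:E = mu `[- c, c]%classic.
  rewrite lebesgue_measure_itv/= lte_fin; case: ifPn => [_|/negP[]]; last lra.
  by rewrite -EFinB; congr (_%:E); rewrite /c; ring.
apply: le_measure; rewrite ?inE; [exact: measurable_itv|exact: m_line|].
move=> x /=; rewrite in_itv/= -ler_norml => xc.
have s1 : `|x / ((1 - t) * y1)| <= 1.
  by rewrite normrM normfV normrM (gtr0_norm t1') ler_pdivrMr ?mul1r ?mulr_gt0.
have t01 : 0 <= t <= 1 by rewrite !ltW.
have K1 : K (0, a / t, b / t).
  apply: K_cube; rewrite ?normr0 ?(ltW r0)// normrM normfV (gtr0_norm t0) ler_pdivrMr//.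
    by rewrite mulrC.
  by rewrite mulrC.
have := K_convex t01 K1 (K_shrink s1 Ky).
by congr (K (_, _, _)); field; rewrite ?y10 ?(gt_eqF t0) ?(gt_eqF t1').
Qed.

Local Notation w := (weight K e).
Local Notation f := (pencil_integral w).

Let mw : measurable_fun setT w.
Proof. exact: (measurable_weight e0 mK). Qed.

Let w0 q : (0 <= w q)%E.
Proof. exact: (weight_ge0 M0 e0 mK K_convex K_sym K_bnd). Qed.

Let m_chord_length m2 m3 : measurable_fun setT (chord_length K m2 m3).
Proof.
have h := @measurable_ge0_integral R _ _ _ _ mu
  (fun (q : R * R) x => (\1_K (x, q.1 + m2 * x, q.2 + m3 * x))%:E).
rewrite (_ : chord_length K m2 m3 =
  fun q => \int[mu]_x (\1_K (x, q.1 + m2 * x, q.2 + m3 * x)%R)%:E)%E.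
  by apply: h => //; meas.
apply/funext => q; rewrite /chord_length -[X in mu X]setIT -integral_indic//.
exact: m_line.
Qed.

Let m_poissonE : measurable_fun setT (fun q : R * R => (poisson_kernel e q.1 q.2)%:E).
Proof. by apply: measurable_EFin; apply: measurable_poisson_kernel; meas. Qed.

Let poissonE_ge0 (q : R * R) : (0 <= (poisson_kernel e q.1 q.2)%:E)%E.
Proof. by rewrite lee_fin poisson_kernel_ge0. Qed.

Let m_poisson_length m2 m3 :
  measurable_fun setT (fun q : R * R => (poisson_kernel e q.1 q.2)%:E * chord_length K m2 m3 q)%E.
Proof. exact: emeasurable_funM. Qed.

Lemma pencil_integral_outside (p : R * R) (z : R) : ~ K (p, z) ->
  (f p z <= (4 * pi ^+ 2)%:E)%E.
Proof.
case: p => y1 y2 Ky; rewrite /pencil_integral/=.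
have [->|y10] := eqVneq y1 0.
  by rewrite normr0 invr0 mul0e lee_fin mulr_ge0// sqr_ge0.
rewrite (integral_weight_line M0 e0 mK K_convex K_sym K_bnd).
have y1n : 0 < `|y1| by rewrite normr_gt0.
apply: (@le_trans _ _ ((`|y1|^-1)%:E * \int[lam2]_q ((poisson_kernel e q.1 q.2)%:E * (2 * `|y1|)%:E))%E).
  apply: lee_wpmul2l; first by rewrite lee_fin invr_ge0.
  apply: ge0_le_integral => //.
  - by move=> q _; rewrite mule_ge0.
  - exact: m_poisson_length.
  - by apply: emeasurable_funM => //; exact: measurable_cst.
  - move=> q _; apply: lee_wpmul2l => //.
    exact: le_trans (chord_length_le_central _ _ _) (chord_length_outside _ _).
rewrite (@ge0_integralZr _ _ _ lam2s) ?lee_fin ?mulr_ge0//.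
rewrite poisson_mass// -!EFinM lee_fin.
have -> : `|y1|^-1 * (2 * pi ^+ 2 * (2 * `|y1|)) = 4 * pi ^+ 2 by field; rewrite gt_eqF.
by [].
Qed.

(** Only the chords through the points [(0, a, b)] with [|a|, |b| <= t r] are retained; their Poisson
    mass tends to the total mass [2 pi^2] as [e] tends to [0]. *)
Lemma pencil_integral_inside (p : R * R) (z t : R) : p.1 != 0 -> K (p, z) -> 0 < t < 1 ->
  ((4 * (1 - t) * (2 * atan (t * r / e)) ^+ 2)%:E <= f p z)%E.
Proof.
case: p => y1 y2 /= y10 Ky t01; rewrite /pencil_integral/=.
rewrite (integral_weight_line M0 e0 mK K_convex K_sym K_bnd).
have y1n : 0 < `|y1| by rewrite normr_gt0.
have t0 : 0 < t by case/andP: t01.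
have t1 : 0 < 1 - t by case/andP: t01 => _ ?; lra.
have c0 : 0 <= 2 * (1 - t) * `|y1| by rewrite mulr_ge0// mulr_ge0// ltW.
pose I := `[(- (t * r))%R, t * r]%classic.
have mI : measurable (I `*` I : set (R * R)).
  by apply: measurableX; exact: measurable_itv.
apply: (@le_trans _ _ ((`|y1|^-1)%:E *
   \int[lam2]_(q in I `*` I) ((poisson_kernel e q.1 q.2)%:E * (2 * (1 - t) * `|y1|)%:E))%E); last first.
  apply: lee_wpmul2l; first by rewrite lee_fin invr_ge0.
  apply: (@le_trans _ _ (\int[lam2]_(q in I `*` I)
     ((poisson_kernel e q.1 q.2)%:E * chord_length K (y2 / y1) (z / y1) q))%E); last first.
    apply: (@ge0_subset_integral _ _ _ lam2s) => //; first exact: m_poisson_length.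
    by move=> q _; rewrite mule_ge0.
  apply: (@ge0_le_integral _ _ _ lam2s) => //.
  - by move=> q _; rewrite mule_ge0// lee_fin.
  - apply: emeasurable_funM; last exact: measurable_cst.
    exact: measurable_funTS.
  - by apply: measurable_funTS; exact: m_poisson_length.
  - move=> [a b] []; rewrite /I/= !in_itv/= -!ler_norml => atr btr.
    exact: (lee_wpmul2l (poissonE_ge0 (a, b)) (chord_length_inside y10 Ky t01 atr btr)).
rewrite (@ge0_integralZr _ _ _ lam2s) ?lee_fin//; last exact: measurable_funTS.
rewrite poisson_mass_square ?mulr_gt0// -!EFinM lee_fin.
set A := _ ^+ 2.
have -> : `|y1|^-1 * (2 * A * (2 * (1 - t) * `|y1|)) = 4 * (1 - t) * A.
  by field; rewrite gt_eqF.
by [].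
Qed.
End Bounds.

(** * Comparison of volumes in coordinates *)

Section Coordinates.
Context {R : realType}.
Local Notation mu := (@lebesgue_measure R).
Local Notation lam2 := (mu \x mu)%E.
Local Notation lam2s := (product_measure mu mu).
Local Notation lam3 := ((mu \x mu) \x mu)%E.
Local Notation lam3s := (product_measure lam2s mu).

(** The measures of [A] and [B] exceed those of the differences by the finite measure of [A `&` B]. *)
Lemma measure_setD_le d (T : measurableType d) (m : {measure set T -> \bar R}) (A B : set T) :
  measurable A -> measurable B -> m (A `&` B) \is a fin_num ->
  (m A <= m B)%E = (m (A `\` B) <= m (B `\` A))%E.
Proof.
move=> mA mB fAB; rewrite (measureDI m mA mB) (measureDI m mB mA) setIC.
by rewrite leeD2rE// setIC.
Qed.

Lemma measure_le_setD_null d (T : measurableType d) (m : {measure set T -> \bar R}) (A N : set T) :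
  measurable A -> measurable N -> m N = 0%E -> (m A <= m (A `\` N))%E.
Proof.
move=> mA mN N0; rewrite (measureDI m mA mN) -[leRHS]adde0; apply: leeD => //.
by rewrite -N0; apply: le_measure; rewrite ?inE//; exact: measurableI.
Qed.

Let line0 : set (R * R) := [set 0] `*` setT.
(** The plane [x = 0], on which [pencil_integral] vanishes, is discarded. *)
Let plane0 : set (R * R * R) := line0 `*` setT.

Let m_line0 : measurable line0.
Proof. exact: measurableX. Qed.

Let m_plane0 : measurable plane0.
Proof. exact: measurableX. Qed.

Let line0_null : lam2 line0 = 0%E.
Proof.
rewrite product_measure1E// [X in (X * _)%E](_ : _ = 0%E) ?mul0e//.
exact: lebesgue_measure_set1.
Qed.

Let plane0_null : lam3 plane0 = 0%E.
Proof.
by rewrite (@product_measure1E _ _ _ _ _ lam2s mu)// [X in (X * _)%E]line0_null mul0e.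
Qed.

Variables (K L : set (R * R * R)) (M r : R).
Hypothesis M0 : 0 < M.
Hypothesis r0 : 0 < r.
Hypothesis mK : measurable K.
Hypothesis mL : measurable L.
Hypothesis K_convex : convex3 K.
Hypothesis K_sym : symmetric3 K.
Hypothesis K_bnd : bounded3 M K.
Hypothesis K_cube : forall x y z, `|x| <= r -> `|y| <= r -> `|z| <= r -> K (x, y, z).

(** The section of [A] by the plane [z = q.2 x + q.1 y], projected along the third axis. *)
Let graph (A : set (R * R * R)) (q : R * R) : set (R * R) :=
  [set p | A (p, q.2 * p.1 + q.1 * p.2)].

Hypothesis sections_le : forall q, (lam2 (graph K q) <= lam2 (graph L q))%E.

Let m_graph A q : measurable A -> measurable (graph A q).
Proof.
move=> mA; apply: (measurable_preimage (f := fun p => (p, q.2 * p.1 + q.1 * p.2))) => //.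
by meas.
Qed.

Let D1 := (K `\` L) `\` plane0.
Let D2 := (L `\` K) `\` plane0.

Let mD1 : measurable D1.
Proof. by apply: measurableD => //; exact: measurableD. Qed.
Let mD2 : measurable D2.
Proof. by apply: measurableD => //; exact: measurableD. Qed.

Let graph_fin q : lam2 (graph K q `&` graph L q) \is a fin_num.
Proof.
rewrite ge0_fin_numE; last exact: (measure_ge0 lam2s).
apply: (@le_lt_trans _ _ (lam2 (`[(- M)%R, M] `*` `[(- M)%R, M]))).
  apply: (@le_measure _ _ _ lam2s); rewrite ?inE.
  - by apply: measurableI; exact: m_graph.
  - by apply: measurableX; exact: measurable_itv.
  - move=> [x y] [/K_bnd[+ + _] _].
    by rewrite !ler_norml /= !in_itv/= => -> ->.
rewrite product_measure1E; [|exact: measurable_itv|exact: measurable_itv].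
have f : mu `[- M, M]%classic \is a fin_num.
  by rewrite lebesgue_measure_itv/=; case: ifP => //; rewrite -EFinB.
by rewrite -ge0_fin_numE ?mule_ge0//; exact: fin_numM.
Qed.

Let graph_D q : (lam2 (graph D1 q) <= lam2 (graph D2 q))%E.
Proof.
have mGK := m_graph q mK; have mGL := m_graph q mL.
have := sections_le q.
rewrite (@measure_setD_le _ _ lam2s) => [h|//|//|]; last exact: graph_fin.
apply: (@le_trans _ _ (lam2 (graph K q `\` graph L q))).
  apply: (@le_measure _ _ _ lam2s); rewrite ?inE; [exact: m_graph|exact: measurableD|].
  by move=> p [[]].
apply: (le_trans h); apply: le_trans (@measure_le_setD_null _ _ lam2s _ line0 _ _ _) _ => //.
  exact: measurableD.
apply: (@le_measure _ _ _ lam2s); rewrite ?inE; [|exact: m_graph|].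
  by apply: measurableD => //; exact: measurableD.
by move=> p [[? ?] pl]; split => // -[].
Qed.

Let D_ne0 p : ~ plane0 p -> p.1.1 != 0.
Proof. by move=> np; apply/eqP => p0; apply: np; split => //; split. Qed.

Let integral_const_indic (D : set (R * R * R)) (c : R) : measurable D -> 0 <= c ->
  (\int[lam2]_p \int[mu]_z ((\1_D (p, z))%:E * c%:E) = c%:E * lam3 D)%E.
Proof.
move=> mD c0; have cE : (0 <= c%:E)%E by rewrite lee_fin.
rewrite spatial_measureE// -(@ge0_integralZl _ _ _ lam2s)//.
- apply: eq_integral => p _; rewrite ge0_integralZr//; first by rewrite muleC.
  by meas.
- have h := @measurable_ge0_integral R _ _ _ _ mu (fun p z => (\1_D (p, z))%:E).
  by apply: h => //; meas.
- by move=> p _; exact: integral_ge0.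
Qed.

(** The chain is: lower bound on [f] over [K \ L], sum over planes, comparison of sections, sum over
    planes, upper bound on [f] over [L \ K]. *)
Let difference_comparison (e t : R) : 0 < e -> 0 < t < 1 ->
  ((4 * (1 - t) * (2 * atan (t * r / e)) ^+ 2)%:E * lam3 (K `\` L) <=
   (4 * pi ^+ 2)%:E * lam3 (L `\` K))%E.
Proof.
move=> e0 t01; set c := 4 * (1 - t) * _.
have c0 : 0 <= c.
  by rewrite /c mulr_ge0 ?sqr_ge0// mulr_ge0//; case/andP: t01; lra.
have d0 : 0 <= 4 * pi ^+ 2 :> R by rewrite mulr_ge0// sqr_ge0.
set w := weight K e; set f := pencil_integral w.
have mw : measurable_fun setT w by exact: (measurable_weight e0 mK).
have w0 q : (0 <= w q)%E by exact: (weight_ge0 M0 e0 mK K_convex K_sym K_bnd).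
have f0 := pencil_integral_ge0 w0.
have mf := measurable_pencil_integral mw w0.
have mp (D : set (R * R * R)) (g : R * R -> R -> \bar R) : measurable D ->
    measurable_fun setT (fun p : R * R * R => g p.1 p.2) ->
    (forall p z, 0 <= g p z)%E ->
    measurable_fun setT (fun p => \int[mu]_z ((\1_D (p, z))%:E * g p z))%E /\
    (forall p, measurable_fun setT (fun z => ((\1_D (p, z))%:E * g p z)%E)).
  move=> mD mg g0; have h : measurable_fun setT
      (fun p : R * R * R => ((\1_D (p.1, p.2))%:E * g p.1 p.2)%E) by meas.
  split.
    have h' := @measurable_ge0_integral R _ _ _ _ mu (fun p z => (\1_D (p, z))%:E * g p z)%E.
    by apply: h' => // p z; rewrite mule_ge0// lee_fin.
  by move=> p; apply: (measurableT_comp (g := fun z : R => (p, z)) h); meas.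
have mono (D : set (R * R * R)) (g g' : R * R -> R -> \bar R) : measurable D ->
    measurable_fun setT (fun p : R * R * R => g p.1 p.2) ->
    measurable_fun setT (fun p : R * R * R => g' p.1 p.2) ->
    (forall p z, 0 <= g p z)%E -> (forall p z, 0 <= g' p z)%E ->
    (forall p z, D (p, z) -> g p z <= g' p z)%E ->
    (\int[lam2]_p \int[mu]_z ((\1_D (p, z))%:E * g p z) <=
     \int[lam2]_p \int[mu]_z ((\1_D (p, z))%:E * g' p z))%E.
  move=> mD mg mg' g0 g'0 gg'.
  have [m1 m2] := mp D g mD mg g0; have [m1' m2'] := mp D g' mD mg' g'0.
  have n (h : R * R -> R -> \bar R) : (forall p z, 0 <= h p z)%E ->
    forall p z, (0 <= (\1_D (p, z))%:E * h p z)%E.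
    by move=> h0 p z; rewrite mule_ge0// lee_fin.
  apply: (@ge0_le_integral _ _ _ lam2s) => //.
  - by move=> p _; apply: integral_ge0 => z _; exact: n.
  move=> p _; apply: ge0_le_integral => //.
  - by move=> z _; exact: n.
  - exact: m2.
  - exact: m2'.
  move=> z _; rewrite indicE; case: (boolP (_ \in _)) => [|_]; last by rewrite !mul0e.
  by rewrite inE => /gg'; rewrite !mul1e.
have mcst (k : R) : measurable_fun setT (fun p : R * R * R => k%:E) by [].
apply: (@le_trans _ _ (c%:E * lam3 D1)%E).
  apply: lee_wpmul2l; first by rewrite lee_fin.
  by apply: (@measure_le_setD_null _ _ lam3s) => //; exact: measurableD.
rewrite -integral_const_indic//.
apply: (@le_trans _ _ (\int[lam2]_p \int[mu]_z ((\1_D1 (p, z))%:E * f p z))%E).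
  apply: mono => //.
  - move=> p z [[Kp _] /D_ne0 p0].
    by apply: (pencil_integral_inside M0 r0 e0 mK K_convex K_sym K_bnd K_cube).
rewrite integral_pencil//; last by move=> p [_ /D_ne0].
apply: (@le_trans _ _ (\int[lam2]_q (w q * lam2 (graph D2 q)))%E).
  have mg (D : set (R * R * R)) : measurable D ->
      measurable_fun setT (fun q => w q * lam2 (graph D q))%E.
    move=> mD; apply: emeasurable_funM => //.
    have h := @measurable_ge0_integral R _ _ _ _ lam2s
      (fun (q : R * R) p => (\1_D (p, q.2 * p.1 + q.1 * p.2))%:E).
    rewrite (_ : (fun q => lam2 (graph D q)) =
      (fun q => \int[lam2]_p (\1_D (p, q.2 * p.1 + q.1 * p.2)%R)%:E)%E).
      by apply: h => //; meas.
    apply/funext => q; rewrite -[X in lam2 X]setIT -integral_indic//.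
    exact: m_graph.
  apply: (@ge0_le_integral _ _ _ lam2s) => //.
  - by move=> q _; apply: mule_ge0 => //; exact: (measure_ge0 lam2s).
  - exact: mg.
  - exact: mg.
  - by move=> q _; apply: lee_wpmul2l => //; exact: graph_D.
rewrite -integral_pencil//; last by move=> p [_ /D_ne0].
apply: (@le_trans _ _ (\int[lam2]_p \int[mu]_z ((\1_D2 (p, z))%:E * (4 * pi ^+ 2)%:E))%E).
  apply: mono => //.
  - move=> p z [[_ Kp] _].
    by apply: (pencil_integral_outside M0 e0 mK K_convex K_sym K_bnd).
rewrite integral_const_indic//; apply: lee_wpmul2l; first by rewrite lee_fin.
apply: (@le_measure _ _ _ lam3s); rewrite ?inE//; first exact: measurableD.
by move=> p [].
Qed.

Let almost_pi (t : R) : 0 < t < 1 ->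
  exists2 e, 0 < e & (1 - t) * pi <= 2 * atan (t * r / e).
Proof.
move=> /andP[t0 t1].
have pi0 : 0 < (pi : R) := pi_gt0 R.
have [N N0 Na] : exists2 N : R, 0 < N & (1 - t) * pi / 2 <= atan N.
  have : \forall N \near +oo%R, (1 - t) * pi / 2 <= (atan N : R).
    have lt : (1 - t) * pi / 2 < pi / 2 :> R by nra.
    have /cvgr_ge := @cvgy_atan R; apply; exact: lt.
  move=> /(filterI (nbhs_pinfty_gt (num_real 0))).
  by move=> /filter_ex[N [N0 Na]]; exists N.
(* so that [t * r / e = N] *)
exists (t * r / N); first by rewrite !mulr_gt0 ?invr_gt0.
have -> : t * r / (t * r / N) = N by field; rewrite !gt_eqF.
by lra.
Qed.

(** If the volume of [K \ L], say [a], exceeded that of [L \ K], say [b], then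
    [difference_comparison] with [t = (a - b) / (6 a)] and a small [e] would give
    [(1 - t)^3 a <= b], whereas [(1 - t)^3 a >= (1 - 3 t) a = (a + b) / 2 > b]. *)
Theorem volume_le_of_sections : (lam3 K <= lam3 L)%E.
Proof.
have Kfin : lam3 K \is a fin_num by exact: (volume_fin_num mK K_bnd).
have KLfin : lam3 (K `\` L) \is a fin_num.
  rewrite ge0_fin_numE; last exact: (measure_ge0 lam3s).
  apply: le_lt_trans (_ : lam3 K < +oo)%E; last by rewrite -ge0_fin_numE//; exact: (measure_ge0 lam3s).
  by apply: (@le_measure _ _ _ lam3s); rewrite ?inE//; exact: measurableD.
have KILfin : lam3 (K `&` L) \is a fin_num.
  rewrite ge0_fin_numE; last exact: (measure_ge0 lam3s).
  apply: le_lt_trans (_ : lam3 K < +oo)%E; last by rewrite -ge0_fin_numE//; exact: (measure_ge0 lam3s).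
  by apply: (@le_measure _ _ _ lam3s); rewrite ?inE//; exact: measurableI.
rewrite (@measure_setD_le _ _ lam3s)//.
have [Lfin|] := boolP (lam3 (L `\` K) \is a fin_num); last first.
  by rewrite ge0_fin_numE ?(measure_ge0 lam3s)// -leNgt => h; exact: (le_trans (leey _) h).
set a := fine (lam3 (K `\` L)); set b := fine (lam3 (L `\` K)).
have aE : lam3 (K `\` L) = a%:E by rewrite fineK.
have bE : lam3 (L `\` K) = b%:E by rewrite fineK.
have a0 : 0 <= a by rewrite -lee_fin -aE; exact: (measure_ge0 lam3s).
have b0 : 0 <= b by rewrite -lee_fin -bE; exact: (measure_ge0 lam3s).
change (lam3 (K `\` L) <= lam3 (L `\` K))%E; rewrite aE bE lee_fin leNgt; apply/negP => ba.
have agt0 : 0 < a by lra.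
pose t := (a - b) / (6 * a).
have t0 : 0 < t by rewrite /t divr_gt0 ?mulr_gt0//; lra.
have tlt : t < 1 by rewrite /t ltr_pdivrMr ?mulr_gt0//; lra.
have ta : t * a = (a - b) / 6 by rewrite /t; field; rewrite gt_eqF.
have t01 : 0 < t < 1 by rewrite t0.
have [e e0 et] := almost_pi t01.
have := difference_comparison e0 t01; rewrite aE bE -!EFinM lee_fin.
have pi0 : 0 < (pi : R) := pi_gt0 R.
have h1 : ((1 - t) * pi) ^+ 2 <= (2 * atan (t * r / e)) ^+ 2.
  by rewrite lerXn2r// nnegrE ?(le_trans _ et)// mulr_ge0// ltW//; lra.
have h2 : 4 * (1 - t) * ((1 - t) * pi) ^+ 2 * a <= 4 * (1 - t) * (2 * atan (t * r / e)) ^+ 2 * a.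
  by rewrite ler_pM2r// ler_pM2l// mulr_gt0//; lra.
move=> h3; have := le_trans h2 h3.
have -> : 4 * (1 - t) * ((1 - t) * pi) ^+ 2 * a = 4 * pi ^+ 2 * ((1 - t) ^+ 3 * a) by ring.
rewrite ler_pM2l ?mulr_gt0 ?exprn_gt0//.
have : (1 - 3 * t) * a <= (1 - t) ^+ 3 * a.
  by rewrite ler_pM2r//; nra.
by lra.
Qed.
End Coordinates.

(** * Convex bodies and central sections in coordinates *)

Section LinearMap.
Context {R : realType}.
Local Notation mu := (@lebesgue_measure R).
Local Notation lam2 := (mu \x mu)%E.
Local Notation lam2s := (product_measure mu mu).

Lemma indic_preimage (T T' : Type) (f : T -> T') (A : set T') (x : T) :
  \1_[set y | A (f y)] x = \1_A (f x) :> R.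
Proof. by []. Qed.

Lemma planar_measureE (B : set (R * R)) : measurable B ->
  (lam2 B = \int[mu]_x \int[mu]_y (\1_B (x, y))%:E)%E.
Proof.
move=> mB; rewrite -[B in LHS]setIT -integral_indic//.
rewrite -(@ge0_integral_prod R _ _ _ _ mu mu (fun x y => (\1_B (x, y))%:E))//; last by meas.
by apply: eq_integral => -[x y] _.
Qed.

Lemma integral_affine_inv (c d : R) (f : R -> \bar R) : c != 0 ->
  measurable_fun setT f -> (forall x, 0 <= f x)%E ->
  (\int[mu]_x f (c * x + d)%R = (`|c|^-1)%:E * \int[mu]_x f x)%E.
Proof.
move=> c0 mf f0; rewrite (ge0_integral_affine d c0 mf f0) muleA -EFinM mulVf ?mul1e//.
by rewrite normr_eq0.
Qed.

(** One affine substitution in each variable; for [b = 0] the map is triangular, and otherwise the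
    first coordinate of the image replaces the second variable. *)
Lemma planar_measure_linear (a b c d : R) : a * d - b * c != 0 ->
  exists2 k : R, 0 < k & forall B, measurable B ->
    (lam2 [set p : R * R | B (a * p.1 + b * p.2, c * p.1 + d * p.2)%R] = k%:E * lam2 B)%E.
Proof.
move=> D0.
have mpre (B : set (R * R)) : measurable B ->
    measurable [set p : R * R | B (a * p.1 + b * p.2, c * p.1 + d * p.2)].
  move=> mB; apply: (measurable_preimage
    (f := fun p => (a * p.1 + b * p.2, c * p.1 + d * p.2))) => //; meas.
have [b0|b0] := eqVneq b 0.
  have : a * d != 0 by move: D0; rewrite b0 mul0r subr0.
  rewrite mulf_eq0 negb_or => /andP[a0 d0].
  exists (`|a|^-1 * `|d|^-1); first by rewrite mulr_gt0 ?invr_gt0 ?normr_gt0.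
  move=> B mB; rewrite planar_measureE ?planar_measureE//; last exact: mpre.
  have mG : measurable_fun setT (fun x => \int[mu]_y (\1_B (x, y))%:E)%E.
    have h := @measurable_ge0_integral R _ _ _ _ mu (fun x y => (\1_B (x, y))%:E).
    by apply: h => //; meas.
  have G0 x : (0 <= \int[mu]_y (\1_B (x, y))%:E)%E by exact: integral_ge0.
  rewrite EFinM -muleA muleCA.
  rewrite -(@integral_affine_inv a 0 _ a0 mG)// -ge0_integralZl ?lee_fin ?invr_ge0//; last first.
    by apply: (measurableT_comp (g := fun x => a * x + 0) mG); meas.
  apply: eq_integral => p _.
  rewrite -(@integral_affine_inv d (c * p) (fun y => (\1_B (a * p + 0, y))%:E))//; last by meas.
  apply: eq_integral => q _; rewrite indic_preimage/= b0 mul0r; congr (\1_B (_, _))%:E.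
  by rewrite addrC.
(* the coefficient of [p.1] in the second coordinate once [p.2] is eliminated *)
pose ka := (c * b - d * a) / b.
have ka0 : ka != 0.
  by rewrite /ka mulf_neq0 ?invr_eq0// -oppr_eq0 opprB mulrC (mulrC c).
exists (`|b|^-1 * `|ka|^-1); first by rewrite mulr_gt0 ?invr_gt0 ?normr_gt0.
move=> B mB; rewrite planar_measureE ?planar_measureE//; last exact: mpre.
transitivity (\int[mu]_p ((`|b|^-1)%:E * \int[mu]_x (\1_B (x, ka * p + d / b * x)%R)%:E))%E.
  apply: eq_integral => p _.
  rewrite -(@integral_affine_inv b (a * p) (fun x => (\1_B (x, ka * p + d / b * x))%:E))//; last by meas.
  apply: eq_integral => q _; rewrite indic_preimage/=; congr (\1_B (_, _))%:E.
    by rewrite addrC.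
  by rewrite /ka; field.
have mG : measurable_fun setT (fun p => \int[mu]_x (\1_B (x, ka * p + d / b * x)%R)%:E)%E.
  have h := @measurable_ge0_integral R _ _ _ _ mu (fun p x => (\1_B (x, ka * p + d / b * x)%R)%:E).
  by apply: h => //; meas.
rewrite ge0_integralZl ?lee_fin ?invr_ge0//; last first.
  by move=> p _; exact: integral_ge0.
rewrite EFinM -muleA; congr (_ * _)%E.
rewrite (@exchange_ge0_integral R _ _ _ _ mu mu
  (fun p x => (\1_B (x, ka * p + d / b * x)%R)%:E))//; last by meas.
rewrite -ge0_integralZl ?lee_fin ?invr_ge0//; last 2 first.
- have h := @measurable_ge0_integral R _ _ _ _ mu (fun x y => (\1_B (x, y))%:E).
  by apply: h => //; meas.
- by move=> x _; exact: integral_ge0.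
apply: eq_integral => x _.
by rewrite -(@integral_affine_inv ka (d / b * x) (fun y => (\1_B (x, y))%:E))//; meas.
Qed.
End LinearMap.

Section Vec3.
Context {R : realType}.
Local Notation mu := (@lebesgue_measure R).
Local Notation lam2 := (mu \x mu)%E.

Definition coord_set (K : set 'rV[R]_3) : set (R * R * R) := @vec3 R @^-1` K.

Let i0 : 'I_3 := ord0.
Let i1 : 'I_3 := lift ord0 ord0.
Let i2 : 'I_3 := ord_max.

Lemma vec3P (v : 'rV[R]_3) : v = vec3 (v 0 i0, v 0 i1, v 0 i2).
Proof.
apply/rowP => i; rewrite mxE; case: i => [[|[|[|//]]] h] /=.
- by congr (v 0 _); exact: val_inj.
- by congr (v 0 _); exact: val_inj.
- by congr (v 0 _); exact: val_inj.
Qed.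

Lemma vec3_lin (s t : R) (p q : R * R * R) :
  s *: vec3 p + t *: vec3 q =
  vec3 (s * p.1.1 + t * q.1.1, s * p.1.2 + t * q.1.2, s * p.2 + t * q.2).
Proof. by apply/rowP => i; rewrite !mxE; case: i => [[|[|[|//]]] h]. Qed.

Lemma dot_vec3 (p q : R * R * R) :
  dot (vec3 p) (vec3 q) = p.1.1 * q.1.1 + p.1.2 * q.1.2 + p.2 * q.2.
Proof. by rewrite /dot !big_ord_recl big_ord0 !mxE /= addr0 addrA. Qed.

Lemma ball_vec3 (p q : R * R * R) (e : R) : 0 < e ->
  ball (vec3 p) e (vec3 q) <->
  [/\ `|p.1.1 - q.1.1| < e, `|p.1.2 - q.1.2| < e & `|p.2 - q.2| < e].
Proof.
move=> e0; split.
  move=> [_ h]; split.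
  - by have := h 0 i0; rewrite !mxE.
  - by have := h 0 i1; rewrite !mxE.
  - by have := h 0 i2; rewrite !mxE.
move=> [h0 h1 h2]; split => // i j; rewrite !mxE.
by case: j => [[|[|[|//]]] h].
Qed.

Variable K : set 'rV[R]_3.
Hypothesis hK : convex_body K.
Hypothesis cK : centered K.

(** The complement is the union of the countably many cubes with rational centers and half-sides that
    it contains. *)
Lemma coord_closed_measurable (A : set 'rV[R]_3) : closed A -> measurable (coord_set A).
Proof.
move=> cA; rewrite -[coord_set A]setCK; apply: measurableC.
pose box (i : rat * rat * rat * rat) : set (R * R * R) :=
  [set p | [/\ `|p.1.1 - ratr i.1.1.1| < ratr i.2, `|p.1.2 - ratr i.1.1.2| < ratr i.2 &
     `|p.2 - ratr i.1.2| < ratr i.2]].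
pose F i := if `[< box i `<=` ~` coord_set A >] then box i else set0.
have -> : ~` coord_set A = \bigcup_i F i.
  apply/seteqP; split; last first.
    by move=> p [i _]; rewrite /F; case: asboolP => // h /h.
  move=> p nAp.
  have : nbhs (vec3 p) (~` A) by apply: open_nbhs_nbhs; split => //; exact: closed_openC.
  move=> /nbhs_ballP[e /= e0 he].
  (* two points of a cube of half-side [d] are less than [2 * d] apart *)
  have [d] : exists d : rat, ratr d \in `]0, e / 2[ by apply: rat_in_itvoo; rewrite divr_gt0.
  rewrite in_itv/= => /andP[d0 de].
  have approx (x : R) : exists a : rat, `|x - ratr a| < ratr d.
    have [a] : exists a : rat, ratr a \in `]x - ratr d, x + ratr d[ by apply: rat_in_itvoo; lra.
    by rewrite in_itv/= => /andP[? ?]; exists a; rewrite ltr_norml; apply/andP; split; lra.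
  have [a ha] := approx p.1.1; have [b hb] := approx p.1.2; have [c hc] := approx p.2.
  exists (a, b, c, d) => //; rewrite /F asboolT//.
  move=> q [/= qa qb qc]; apply: he; apply/ball_vec3 => //.
  have tri (x y z : R) : `|x - z| < ratr d -> `|y - z| < ratr d -> `|x - y| < e.
    by rewrite !ltr_norml => /andP[? ?] /andP[? ?]; apply/andP; split; lra.
  by split; [exact: tri ha qa|exact: tri hb qb|exact: tri hc qc].
apply: countable_bigcupT_measurable; first exact: countableP.
move=> i; rewrite /F; case: asboolP => // _.
have mb (f : R * R * R -> R) (c d : R) : measurable_fun setT f ->
    measurable [set p | `|f p - c| < d].
  move=> mf; have mg : measurable_fun setT (fun p => `|f p - c|) by meas.
  have := measurable_preimage mg (measurable_itv `]-oo, d[).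
  by congr measurable; apply/seteqP; split => p /=; rewrite in_itv.
have -> : box i = [set p | `|p.1.1 - ratr i.1.1.1| < ratr i.2] `&`
   [set p | `|p.1.2 - ratr i.1.1.2| < ratr i.2] `&` [set p | `|p.2 - ratr i.1.2| < ratr i.2].
  by apply/seteqP; split => p; [move=> [? ? ?]|move=> [[? ?] ?]].
by apply: measurableI; [apply: measurableI|]; apply: mb; meas.
Qed.

Lemma coord_measurable : measurable (coord_set K).
Proof.
apply: coord_closed_measurable; apply: compact_closed; first exact: norm_hausdorff.
by case: hK.
Qed.

Lemma coord_bounded : exists2 M, 0 < M & bounded3 M (coord_set K).
Proof.
have [/compact_bounded[M [_ hM]] _ _] := hK.
exists (`|M| + 2); first by have := normr_ge0 M; lra.
move=> x y z Kv.
have MM : M < `|M| + 1 by have := ler_norm M; lra.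
have := hM _ MM _ Kv => /= h.
have : ball (vec3 (0, 0, 0)) (`|M| + 2) (vec3 (x, y, z)).
  rewrite -ball_normE /=.
  have -> : vec3 (0, 0, 0) = 0 :> 'rV[R]_3.
    by apply/rowP => i; rewrite !mxE; case: i => [[|[|[|//]]] ?].
  by rewrite sub0r normrN; apply: le_lt_trans h _; lra.
move=> /ball_vec3 => /(_ _)[|/=]; first by have := normr_ge0 M; lra.
by rewrite !sub0r !normrN => /ltW ? /ltW ? /ltW ?.
Qed.

Lemma coord_convex : convex3 (coord_set K).
Proof.
move=> t x y z x' y' z' /andP[t0 t1] Kp Kq; have [_ cvK _] := hK.
have := cvK (vec3 (x, y, z)) (vec3 (x', y', z')) (Itv01 t0 t1).
rewrite !inE => /(_ Kp Kq); rewrite /coord_set/=.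
by rewrite -(vec3_lin t (1 - t) (x, y, z) (x', y', z')).
Qed.

Lemma coord_sym : symmetric3 (coord_set K).
Proof.
move=> x y z; rewrite /coord_set/= => Kp; rewrite cK /=; exists (vec3 (x, y, z)) => //.
by apply/rowP => i; rewrite !mxE; case: i => [[|[|[|//]]] ?].
Qed.

(** If [v + x] and [v - x] are in [K], then so are [v + x] and [x - v], whose mean is [x]. *)
Lemma coord_cube : exists2 r, 0 < r &
  forall x y z, `|x| <= r -> `|y| <= r -> `|z| <= r -> coord_set K (x, y, z).
Proof.
have [_ _ [v]] := hK; rewrite /interior => /nbhs_ballP[e /= e0 he].
move: he; rewrite (vec3P v); set a := v 0 i0; set b := v 0 i1; set c := v 0 i2 => he.
exists (e / 2); first by rewrite divr_gt0.
move=> x y z hx hy hz.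
have K1 : coord_set K (a + x, b + y, c + z).
  by apply: he; apply/ball_vec3 => //=; rewrite !opprD !addNKr !normrN; split; lra.
have K2 : coord_set K (a - x, b - y, c - z).
  by apply: he; apply/ball_vec3 => //=; rewrite !opprD !addNKr !normrN; split; lra.
have h01 : 0 <= (2^-1 : R) <= 1 by apply/andP; split; lra.
have := coord_convex h01 K1 (coord_sym K2).
by congr (coord_set K (_, _, _)); field.
Qed.
End Vec3.

Section CentralSections.
Context {R : realType}.
Local Notation mu := (@lebesgue_measure R).
Local Notation lam2 := (mu \x mu)%E.

Lemma enorm_eq1 (v : 'rV[R]_3) : enorm v = 1 -> dot v v = 1.
Proof.
rewrite /enorm => h; rewrite -(@sqr_sqrtr _ (dot v v)) ?h ?expr1n//.
by rewrite (vec3P v) dot_vec3 !addr_ge0// -expr2 sqr_ge0.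
Qed.

(** The normal vector of [z = al x + be y] is proportional to [(al, be, -1)].  In any orthonormal basis
    of the plane, the projection along the third axis is a linear isomorphism onto the
    [(x, y)]-plane, so that the area is proportional to that of the projection, by a factor that does not
    depend on [K]. *)
Lemma area_in_perp_graph (al be : R) : exists2 u : 'rV[R]_3, unit_sphere u &
  exists2 k : R, 0 < k & forall K : set 'rV[R]_3, measurable (coord_set K) ->
    (area_in_perp u (K `&` perp u) =
     k%:E * lam2 [set p | coord_set K (p, al * p.1 + be * p.2)%R])%E.
Proof.
pose s := Num.sqrt (al ^+ 2 + be ^+ 2 + 1).
have s2 : s ^+ 2 = al ^+ 2 + be ^+ 2 + 1 by rewrite sqr_sqrtr// !addr_ge0 ?sqr_ge0.
have s0 : 0 < s by rewrite sqrtr_gt0 ltr_pwDr// addr_ge0 ?sqr_ge0.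
pose u := vec3 (s^-1 * al, s^-1 * be, - s^-1).
have perpE (p : R * R * R) : perp u (vec3 p) <-> p.2 = al * p.1.1 + be * p.1.2.
  rewrite /perp /= dot_vec3 /=.
  have -> : p.1.1 * (s^-1 * al) + p.1.2 * (s^-1 * be) + p.2 * - s^-1 =
     s^-1 * (al * p.1.1 + be * p.1.2 - p.2) by ring.
  split; last by move=> ->; rewrite subrr mulr0.
  move/eqP; rewrite mulf_eq0 invr_eq0 (gt_eqF s0) /= subr_eq0 => /eqP ->//.
have u1 : unit_sphere u.
  rewrite /unit_sphere/= /enorm dot_vec3 /=.
  have -> : s^-1 * al * (s^-1 * al) + s^-1 * be * (s^-1 * be) + - s^-1 * - s^-1 =
    (al ^+ 2 + be ^+ 2 + 1) / s ^+ 2 by field; rewrite gt_eqF.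
  by rewrite -s2 divff ?sqrtr1// expf_neq0// gt_eqF.
exists u => //.
have := xgetPex (0, 0) (perp_basis_exists u1).
set basis := xget _ _ => basisP.
have [[[a c] v2] [[[b d] w2] basisE]] : exists p q, basis = (vec3 p, vec3 q).
  by case: basis {basisP} => v w; do 2 eexists; congr (_, _); exact: vec3P.
move: basisP; rewrite basisE => -[/= /perpE/= v2E /perpE/= w2E].
move=> /enorm_eq1; rewrite dot_vec3/= => vv /enorm_eq1; rewrite dot_vec3/= => ww.
rewrite dot_vec3/= => vw.
(* Gram's determinant: the squared length of the cross product of the basis vectors. *)
have D2 : (a * d - b * c) ^+ 2 * (1 + al ^+ 2 + be ^+ 2) = 1.
  transitivity ((a * a + c * c + v2 * v2) * (b * b + d * d + w2 * w2) -
    (a * b + c * d + v2 * w2) ^+ 2); first by rewrite v2E w2E; ring.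
  by rewrite vv ww vw expr0n subr0 mulr1.
have D0 : a * d - b * c != 0.
  by apply/eqP => D0; move: D2; rewrite D0 expr0n mul0r => /esym/eqP; rewrite oner_eq0.
have [k k0 kE] := planar_measure_linear D0.
exists k => // K mK; rewrite /area_in_perp -/basis basisE /=.
rewrite -(kE [set p | coord_set K (p, al * p.1 + be * p.2)]); last first.
  apply: (measurable_preimage (f := fun p => (p, al * p.1 + be * p.2))) => //.
  by meas.
congr (lam2 _); apply/seteqP; split => -[x y] /=; rewrite vec3_lin/= v2E w2E.
  move=> [Kp _]; rewrite /coord_set/=.
  by move: Kp; congr (K (vec3 (_, _, _))); ring.
rewrite /coord_set/= => Kp; split; last by apply/perpE => /=; ring.
by move: Kp; congr (K (vec3 (_, _, _))); ring.
Qed.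

End CentralSections.

Unset Implicit Arguments.
Set Strict Implicit.
Set Printing Implicit Defensive.

Theorem mainTheorem1 (R : realType) (K1 K2 : set 'rV[R]_3)
    (hK1 : convex_body K1) (cK1 : centered K1)
    (hK2 : convex_body K2) (cK2 : centered K2)
    (hsec : forall u : 'rV[R]_3, unit_sphere u ->
      (area_in_perp u (K1 `&` perp u) <= area_in_perp u (K2 `&` perp u))%E) :
  (volume K1 <= volume K2)%E.
Proof.
have m1 := coord_measurable hK1; have m2 := coord_measurable hK2.
have [M M0 bnd] := coord_bounded hK1.
have [r r0 cube] := coord_cube hK1 cK1.
apply: (volume_le_of_sections M0 r0 m1 m2 (coord_convex hK1) (coord_sym cK1) bnd cube).
move=> q; have [u u1 [k k0 kE]] := @area_in_perp_graph R q.2 q.1.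
have := hsec u u1; by rewrite !kE// lee_pmul2l.
Qed.
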